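(* Let $\lambda,\lambda_1,\beta>0$. Let $E_N$ be a compound Poisson process with intensity $\lambda$ and exponentially distributed jumps with rate $\beta$, let $Y(t)=\inf\{u\ge 0: E_N(u)>t\}$, $t\ge 0$, be its inverse process, and let $N_1$ be a Poisson process with intensity $\lambda_1$ independent of $Y$. Put $Z(t)=N_1(Y(t))$. Then the probability mass function of $Z(t)$ is given by $$P(Z(t)=k)=e^{-\beta t}\,\frac{\lambda\lambda_1^{k}(k+1)}{(\lambda_1+\lambda)^{k+1}}\,\mathcal{E}_{1,1}^{k+1}\left(\frac{\lambda t\beta}{\lambda_1+\lambda}\right),\qquad k=0,1,2,\ldots;$$ the mean and variance are $$\mathsf{E}Z(t)=\frac{\lambda_1}{\lambda}(\beta t+1),\qquad \mathsf{Var}Z(t)=\frac{\lambda_1^{2}}{\lambda^{2}}(2\beta t+1)+\frac{\lambda_1}{\lambda}(\beta t+1);$$ the covariance function is $$\mathsf{Cov}(Z(t),Z(s))=\frac{\lambda_1^{2}}{\lambda^{2}}\bigl(2\beta\min(t,s)+1\bigr)+\frac{\lambda_1}{\lambda}\bigl(\beta\min(t,s)+1\bigr);$$ and the Laplace transform is given by $$\mathsf{E}e^{-\theta Z(t)}=\frac{\lambda}{\lambda+\lambda_1(1-e^{-\theta})}\exp\left(-\beta t\,\frac{\lambda_1(1-e^{-\theta})}{\lambda+\lambda_1(1-e^{-\theta})}\right).$$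
   Context: $E_N(t)=\sum_{j=1}^{N(t)}\xi_j$, where $N$ is a Poisson process with intensity $\lambda$ and $\xi_j$ are i.i.d. exponential random variables with rate $\beta$ (density $\beta e^{-\beta x}$, $x>0$), independent of $N$ (empty sum $=0$). The three-parameter generalized Mittag-Leffler function is $\mathcal{E}_{\rho,\delta}^{\gamma}(z)=\sum_{j=0}^{\infty}\frac{\Gamma(\gamma+j)}{\Gamma(\gamma)}\frac{z^{j}}{j!\,\Gamma(\rho j+\delta)}$.
   Formalization: The printed probability mass function is false (at t=0 its total mass is (λ+λ₁)/λ > 1); the factor (k+1) is removed, so P(Z(t)=k)=e^{-βt} λλ₁^k/(λ₁+λ)^{k+1} times the Mittag-Leffler value. The Laplace transform is stated for θ≥0. *)

(* Defs.v *)
From HB Require Import structures.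
From mathcomp Require Export all_boot all_order all_algebra finmap.
From mathcomp Require Export all_classical all_reals all_analysis.

Set Implicit Arguments.
Unset Strict Implicit.
Unset Printing Implicit Defensive.

Export Order.TTheory GRing.Theory Num.Theory.
Export numFieldNormedType.Exports.

Local Open Scope classical_set_scope.
Local Open Scope ring_scope.

(* Euler's integral; meant for x > 0, where it converges. *)
Definition Gamma {R : realType} (x : R) : R :=
  \int[lebesgue_measure]_(s in `]0, +oo[) (s `^ (x - 1) * expR (- s)).

(* Meant for rho, delta, gamma > 0, where the series converges for every z. *)
Definition mittag_leffler {R : realType} (rho delta gamma z : R) : R :=
  limn (series (fun j : nat =>
    Gamma (gamma + j%:R) / Gamma gamma *
    (z ^+ j / (j`!%:R * Gamma (rho * j%:R + delta))))).

Definition mutually_independent {d d'} {T : measurableType d}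
    {U : measurableType d'} {R : realType} (P : probability T R)
    {I : choiceType} (X : I -> T -> U) : Prop :=
  forall (J : {fset I}) (B : I -> set U), (forall i, measurable (B i)) ->
    P (\bigcap_(i in [set` J]) (X i @^-1` B i)) =
    (\prod_(i <- J) P (X i @^-1` B i))%E.

Definition process_sigma {d d'} {T : measurableType d} {U : measurableType d'}
    {I : Type} (D : set I) (X : I -> T -> U) : set (set T) :=
  <<s \bigcup_(i in D) preimage_set_system setT (X i) measurable >>.

Definition independent_systems {d} {T : measurableType d} {R : realType}
    (P : probability T R) (F G : set (set T)) : Prop :=
  forall A B, F A -> G B -> P (A `&` B) = (P A * P B)%E.

(* Time runs over [0, +oo[: the values of N at negative times are
   unconstrained and never used.  The path properties hold for every outcome,
   as for any counting process; nat carries the discrete topology, so the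
   limit in pp_right_continuous says that N _ w is constant just after t. *)
Record poisson_process {d} {T : measurableType d} {R : realType}
    (P : probability T R) (lam : R) (N : R -> T -> nat) : Prop := {
  pp_measurable : forall t, 0 <= t -> measurable_fun setT (N t) ;
  pp_start : forall w, N 0 w = 0%N ;
  pp_nondecreasing : forall w s t, 0 <= s -> s <= t -> (N s w <= N t w)%N ;
  pp_right_continuous : forall w t, 0 <= t -> N x w @[x --> t^'+] --> N t w ;
  pp_independent_increments : forall t : nat -> R, 0 <= t 0%N ->
    nondecreasing_seq t ->
    mutually_independent P (fun (i : nat) w => (N (t i.+1) w - N (t i) w)%N) ;
  pp_law : forall s t, 0 <= s -> s < t -> forall k : nat,
    P [set w | (N t w - N s w)%N = k] = (poisson_pmf (lam * (t - s)) k)%:E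
}.

Definition compound_process {T : Type} {R : realType} (N : R -> T -> nat)
    (xi : nat -> T -> R) (u : R) (w : T) : R :=
  \sum_(j < N u w) xi j w.

(* inf is real-valued, with inf set0 = 0; for a compound Poisson process with
   exponential jumps the set below is empty only on a null event. *)
Definition inverse_process {T : Type} {R : realType} (E : R -> T -> R)
    (t : R) (w : T) : R :=
  inf [set u | 0 <= u /\ t < E u w].

(* Let N be Poisson of intensity lam1 and let Y be the inverse of a compound
   Poisson process (intensity lam, jumps exponential of rate beta), independent
   of N.  Then the mass of time_changed N Y t at k is
     e^(- beta t) lam lam1^k / (lam1 + lam)^(k+1)
       * mittag_leffler 1 1 (k+1) (lam t beta / (lam1 + lam)).
   This formula is also found with a further factor k + 1; that version is
   wrong: at t = 0 its total mass is (lam + lam1) / lam instead of 1. *)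
Definition time_changed {T : Type} {R : realType} (N : R -> T -> nat)
    (Y : R -> T -> R) (t : R) (w : T) : nat :=
  N (Y t w) w.

(* Main.v *)
(* Let S_n be the sum of the first n jumps, so that E(u) = S_{N(u)}, and let M(t)
   be the number of n >= 1 with S_n <= t.  Almost surely u < Y(t) iff E(u) <= t,
   hence
     P(u < Y(t)) = sum_a P(N(u) = a) P(S_a <= t),
   and likewise for two times with the independent increments of N.  Since a
   Poisson weight exp(- lam u) (lam u)^a / a! integrates to 1 / lam over u >= 0,
   E Y(t) and E (Y(s) Y(t)) reduce to sums of P(S_a <= s, S_{a+b} <= t), and
   integrating P(u < Y(t)) against another Poisson weight gives, by the gamma law
   of S_a, a mixture of negative binomial weights over the Poisson variable M(t).
   Independence of N1 and Y allows N1 to be averaged out with Y frozen: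
     P(Z(t) = k) = E (exp(- lam1 Y) (lam1 Y)^k / k!),
     E exp(- theta Z(t)) = E exp(- lam1 (1 - exp(- theta)) Y),
     E (Z(s) Z(t)) = lam1^2 E (Y(s) Y(t)) + lam1 E Y(s)  for s <= t. *)

Require Import Defs.
From HB Require Import structures.
From mathcomp Require Import all_boot all_order all_algebra finmap.
From mathcomp Require Import all_classical all_reals all_analysis.
From mathcomp Require Import measurable_realfun ring lra.

Import Order.TTheory GRing.Theory Num.Theory.
Import numFieldNormedType.Exports.

Local Open Scope classical_set_scope.
Local Open Scope ring_scope.

Set Implicit Arguments.
Unset Strict Implicit.
Unset Printing Implicit Defensive.

(** * Poisson weights *)

(** The only analytic tool is the fundamental theorem of calculus, fed by one fact: the Poisson tail
    [ptail x n.+1] is an antiderivative in [x] of the weight [pois x n]. Laws enter through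
    distribution functions alone: when [F' = f], the difference [F (Y t) - F 0] is the integral of
    [f u] over [0 <= u < Y t], and Tonelli leaves only P(u < Y(t)). Since this wants [f >= 0], and a
    Poisson weight is not monotone in its intensity, the mean of [pois (c * Y t) k] is obtained as a
    difference of means of two tails. One formula with a free rate [c] then serves twice: [c = lam1]
    gives the mass function, and [k = 0], [c = lam1 (1 - exp(-theta))] the Laplace transform. Null
    events shape the rest. On them jumps may be negative and the compound process bounded, so that
    [Y] may be the infimum of an empty set; it is monotone in [t] only almost surely, whereas its
    measurability has to hold with no exceptional set. Independence is given between
    sub-sigma-algebras, so averaging [N1] with [Y] frozen takes joint measurability for the product
    of those two. *)

Section ftc.
Context {R : realType}.
Notation mu := (@lebesgue_measure R).

Lemma is_derive1_continuous (F f : R -> R) :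
  (forall x : R, is_derive x 1 F (f x)) -> continuous F.
Proof.
move=> dF x; apply: differentiable_continuous.
by apply/derivable1_diffP; exact: (@ex_derive _ _ _ _ _ _ _ (dF x)).
Qed.

Lemma integral_itv_is_derive (F f : R -> R) (a b : R) : a <= b ->
  (forall x : R, is_derive x 1 F (f x)) -> continuous f ->
  (\int[mu]_(x in `[a, b]) (f x)%:E = (F b - F a)%:E)%E.
Proof.
rewrite le_eqVlt => /predU1P[<- _ _|ab dF cf].
  by rewrite set_itv1 integral_set1 subrr.
have cF := is_derive1_continuous dF.
rewrite EFinB; apply: continuous_FTC2 => //.
- by apply: continuous_subspaceT => x; exact: cf.
- split.
  + by move=> x _; exact: (@ex_derive _ _ _ _ _ _ _ (dF x)).
  + exact: cvg_at_right_filter (cF a).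
  + exact: cvg_at_left_filter (cF b).
- by move=> x _; rewrite derive1E; exact: (@derive_val _ _ _ _ _ _ _ (dF x)).
Qed.

Lemma integral_itvy_is_derive (F f : R -> R) (a l : R) :
  (forall x, a <= x -> 0 <= f x) ->
  (forall x : R, is_derive x 1 F (f x)) -> continuous f ->
  F x @[x --> +oo] --> l ->
  (\int[mu]_(x in `[a, +oo[) (f x)%:E = (l - F a)%:E)%E.
Proof.
move=> f0 dF cf Fl.
have cF := is_derive1_continuous dF.
rewrite EFinB; apply: ge0_continuous_FTC2y => //.
- by apply: continuous_subspaceT => x; exact: cf.
- exact: cvg_at_right_filter (cF a).
- by move=> x _; rewrite derive1E; exact: (@derive_val _ _ _ _ _ _ _ (dF x)).
Qed.

End ftc.

Section poisson_weights.
Context {R : realType}.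
Implicit Types x y : R.
Notation mu := (@lebesgue_measure R).

(* Unlike [poisson_pmf], the right value (a unit mass at 0) at intensity 0. *)
Definition pois x k : R := x ^+ k * k`!%:R^-1 * expR (- x).

(** The probability that a Poisson variable of mean [x] is at least [n]. Read as a function of [x],
    it is the distribution function of a sum of [n] independent exponentials of rate 1, the gamma
    law met again in [bsum_cdf]. *)
Definition ptail x n : R := 1 - \sum_(i < n) pois x i.

Lemma pois_ge0 x k : 0 <= x -> 0 <= pois x k.
Proof. by move=> x0; rewrite /pois !mulr_ge0 ?exprn_ge0 ?expR_ge0. Qed.

Lemma poisson_pmfE x k : 0 < x -> poisson_pmf x k = pois x k.
Proof. by rewrite /poisson_pmf => ->. Qed.

Lemma pois0l k : pois 0 k = (k == 0%N)%:R.
Proof.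
by rewrite /pois oppr0 expR0 mulr1 expr0n; case: k => [|k] /=; rewrite ?mul0r
  ?fact0 ?invr1 ?mulr1.
Qed.

Lemma pois0r x : pois x 0 = expR (- x).
Proof. by rewrite /pois expr0 fact0 invr1 !mul1r. Qed.

Lemma poisS x k : k.+1%:R * pois x k.+1 = x * pois x k.
Proof.
rewrite /pois factS natrM exprS; field.
by rewrite nat1r !pnatr_eq0 -lt0n fact_gt0.
Qed.

Lemma ptail0 x : ptail x 0 = 1.
Proof. by rewrite /ptail big_ord0 subr0. Qed.

Lemma ptailS x n : ptail x n = pois x n + ptail x n.+1.
Proof. by rewrite /ptail big_ord_recr/=; ring. Qed.

Lemma ptail0l n : ptail 0 n.+1 = 0.
Proof.
rewrite /ptail big_ord_recl pois0l eqxx big1 ?addr0 ?subrr// => i _.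
by rewrite pois0l.
Qed.

Lemma is_derive_pois0 x : is_derive x 1 (pois^~ 0%N) (- pois x 0).
Proof.
rewrite (_ : pois^~ 0%N = fun x => expR (- x)); last first.
  by apply/funext => y; rewrite pois0r.
by apply: is_derive_eq; rewrite pois0r /GRing.scale/= mulrN1.
Qed.

Lemma is_derive_poisS x k :
  is_derive x 1 (pois^~ k.+1) (pois x k - pois x k.+1).
Proof.
have dX : is_derive x 1 (fun y : R => y ^+ k.+1) (k.+1%:R * x ^+ k).
  have h := @is_deriveX _ _ id k.+1 x 1 1 (is_derive_id _ _).
  by rewrite exprfctE in h; apply: (is_derive_eq h); rewrite /GRing.scale/=
    mulr1.
have dE : is_derive x 1 (fun y : R => expR (- y)) (- expR (- x)).
  by apply: is_derive_eq; rewrite /GRing.scale/= mulrN1.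
have /(@is_deriveZ _ _ _ _ (k.+1`!%:R^-1)) := is_deriveM dX dE.
rewrite (_ : _ \*: _ = pois^~ k.+1); last first.
  apply/funext => y.
  transitivity (k.+1`!%:R^-1 * (y ^+ k.+1 * expR (- y))) => //.
  by rewrite /pois; ring.
move/is_derive_eq; apply.
rewrite /pois /GRing.scale /= factS natrM exprS.
by field; rewrite nat1r !pnatr_eq0 -lt0n fact_gt0.
Qed.

(** The derivatives of successive weights telescope, so that a single Poisson weight survives. The
    integrals of Poisson weights are read off from this antiderivative. *)
Lemma is_derive_ptail x n : is_derive x 1 (ptail^~ n.+1) (pois x n).
Proof.
elim: n => [|n IH].
  rewrite (_ : ptail^~ 1%N = cst 1 \- pois^~ 0%N); last first.
    by apply/funext => y; rewrite /ptail big_ord1.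
  have := is_derive_pois0 x => ?.
  by apply: is_derive_eq; rewrite sub0r opprK.
rewrite (_ : ptail^~ n.+2 = ptail^~ n.+1 \- pois^~ n.+1); last first.
  by apply/funext => y /=; rewrite [in RHS]ptailS addrC addKr.
have := is_derive_poisS x n => ?.
by apply: is_derive_eq; ring.
Qed.

Lemma is_derive_scale (F : R -> R) (a x f : R) : is_derive (a * x : R) 1 F f ->
  is_derive x 1 (fun y => F (a * y)) (a * f).
Proof.
move=> dF.
have h : is_derive x 1 (fun y => a * y) a.
  by apply: is_derive_eq; rewrite /GRing.scale/= mulr1.
by have := @is_derive1_comp _ F (fun y => a * y) x f a dF h; rewrite mulrC.
Qed.

Lemma continuous_pois k : continuous (pois^~ k : R -> R).
Proof.
case: k => [|k].
- exact: is_derive1_continuous is_derive_pois0.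
- exact: is_derive1_continuous (is_derive_poisS^~ k).
Qed.

Lemma measurable_pois k : measurable_fun setT (pois^~ k : R -> R).
Proof. by apply: continuous_measurable_fun; exact: continuous_pois. Qed.

Lemma measurable_ptail n : measurable_fun setT (ptail^~ n : R -> R).
Proof.
case: n => [|n].
  by rewrite (_ : ptail^~ 0%N = cst 1)//; apply/funext => x; rewrite ptail0.
by apply: continuous_measurable_fun; exact: is_derive1_continuous
  (is_derive_ptail^~ n).
Qed.

Lemma integral_pois0 x k : 0 <= x ->
  (\int[mu]_(u in `[0%R, x]) (pois u k)%:E = (ptail x k.+1)%:E)%E.
Proof.
move=> x0; rewrite (integral_itv_is_derive x0 (fun u => is_derive_ptail u k)).
  by rewrite ptail0l subr0.
exact: continuous_pois.
Qed.

(** The defining difference does not show the sign; an integral of nonnegative weights over [[0, x]]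
    does. *)
Lemma ptail_ge0 x n : 0 <= x -> 0 <= ptail x n.
Proof.
move=> x0; case: n => [|n]; first by rewrite ptail0.
rewrite -lee_fin -integral_pois0//; apply: integral_ge0 => u /=.
by rewrite in_itv/= => /andP[u0 _]; rewrite lee_fin pois_ge0.
Qed.

Lemma ptail_le1 x n : 0 <= x -> ptail x n <= 1.
Proof.
by move=> x0; rewrite /ptail gerBl sumr_ge0// => i _; exact: pois_ge0.
Qed.

Lemma pois_series1 x : 0 <= x -> (\sum_(k <oo) (pois x k)%:E = 1)%E.
Proof.
rewrite le_eqVlt => /predU1P[<-|x0].
  rewrite (@nneseriesD1 _ _ 0%N)//; last by move=> k _; rewrite lee_fin
    pois_ge0.
  rewrite pois0l eqxx eseries0 ?adde0// => k _ k0.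
  by rewrite pois0l (negbTE k0).
rewrite -[RHS](probability_setT (poisson_prob x 0)) /= /poisson_prob x0.
rewrite nneseries_esumT; last by move=> k; rewrite lee_fin pois_ge0 // ltW.
by apply: eq_esum => k _; rewrite poisson_pmfE.
Qed.

(** The indicator makes the sum run over all [k], so that sums over [n] and [k] can be interchanged
    in [expectation_ptail_inverse]. *)
Lemma ptailE x n : 0 <= x ->
  ((ptail x n)%:E = \sum_(k <oo) ((n <= k)%N%:R * pois x k)%:E)%E.
Proof.
move=> x0; have p0 k : (0 <= (pois x k)%:E)%E by rewrite lee_fin pois_ge0.
rewrite /ptail EFinB -(pois_series1 x0) (@nneseries_split _ _ 0%N n)//.
rewrite [X in (X + _ - _)%E](_ : _ = (\sum_(i < n) pois x i)%:E); last first.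
  by rewrite add0n big_mkord sumEFin.
rewrite addeAC subee// add0e [in RHS](@nneseries_split _ _ 0%N n); last first.
  by move=> k _; rewrite lee_fin mulr_ge0 ?pois_ge0.
rewrite add0n big_nat_cond big1 ?add0e.
  rewrite [LHS]eseries_cond [RHS]eseries_cond; apply: eq_eseriesr => k.
  by move=> /= ->; rewrite mul1r.
by move=> i; rewrite andbT => /andP[_ ni]; rewrite leqNgt ni mul0r.
Qed.

End poisson_weights.

(** * Moments and integrals of Poisson weights; negative binomial weights *)

Section poisson_sums.
Context {R : realType}.
Implicit Types x y z : R.
Notation mu := (@lebesgue_measure R).

Lemma nneseriesS (f : nat -> \bar R) : (forall k, 0 <= f k)%E ->
  (\sum_(k <oo) f k = f 0%N + \sum_(k <oo) f k.+1)%E.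
Proof.
move=> f0; rewrite (@nneseries_split _ f 0 1)//.
rewrite add0n big_nat1; congr (_ + _)%E.
rewrite -(nneseries_addn 1)//.
by apply: eq_eseriesr => k _; rewrite addn1.
Qed.

(** [poisS] turns the factor [k] into a shift of index. Constant [f] and [f k = k] give the first
    two moments. *)
Lemma poisson_stein_chen x (f : nat -> \bar R) : 0 <= x ->
  (forall k, 0 <= f k)%E ->
  (\sum_(k <oo) (pois x k)%:E * (k%:R%:E * f k) =
   x%:E * \sum_(k <oo) (pois x k)%:E * f k.+1)%E.
Proof.
move=> x0 f0; have p0 k : (0 <= (pois x k)%:E)%E by rewrite lee_fin pois_ge0.
rewrite nneseriesS; last first.
  by move=> k; rewrite !mule_ge0// lee_fin ler0n.
rewrite mul0e mule0 add0e -nneseriesZl//; last first.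
  by move=> k _; rewrite mule_ge0.
by apply: eq_eseriesr => k _; rewrite !muleA -!EFinM -poisS (mulrC (pois x _)).
Qed.

Lemma pois_mean x : 0 <= x ->
  (\sum_(k <oo) (pois x k)%:E * k%:R%:E = x%:E)%E.
Proof.
move=> x0; rewrite -[RHS]mule1 -(pois_series1 x0).
under [in RHS]eq_eseriesr do rewrite -[(pois x _)%:E]mule1.
rewrite -(poisson_stein_chen (f := cst 1%E) x0)//.
by apply: eq_eseriesr => k _; rewrite mule1.
Qed.

Lemma pois_moment2 x : 0 <= x ->
  (\sum_(k <oo) (pois x k)%:E * (k%:R ^+ 2)%:E = (x ^+ 2 + x)%:E)%E.
Proof.
move=> x0.
have p0 k : (0 <= (pois x k)%:E)%E by rewrite lee_fin pois_ge0.
transitivity (\sum_(k <oo) (pois x k)%:E * (k%:R%:E * k%:R%:E))%E.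
  by apply: eq_eseriesr => k _; rewrite -EFinM.
rewrite (poisson_stein_chen (f := fun k => k%:R%:E))//.
transitivity (x%:E * (\sum_(k <oo) ((pois x k)%:E * k%:R%:E + (pois x
  k)%:E)))%E.
  congr (_ * _)%E; apply: eq_eseriesr => k _.
  by rewrite -natr1 EFinD muleDr// mule1.
rewrite nneseriesD//; last by move=> k _; rewrite mule_ge0// lee_fin ler0n.
rewrite pois_mean// pois_series1// -EFinD -EFinM.
by congr EFin; ring.
Qed.

(** Split [exp(-x)] as [exp(-x (1 - z)) exp(-x z)]: the second factor completes the terms to Poisson
    weights of intensity [x z], which sum to 1. *)
Lemma pois_gen_fun x z : 0 <= x -> 0 <= z ->
  (\sum_(k <oo) (pois x k)%:E * (z ^+ k)%:E = (expR (- (x * (1 - z))))%:E)%E.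
Proof.
move=> x0 z0; have xz0 : 0 <= x * z by rewrite mulr_ge0.
transitivity (\sum_(k <oo) (expR (- (x * (1 - z))))%:E * (pois (x * z) k)%:E)%E.
  apply: eq_eseriesr => k _; rewrite -!EFinM; congr EFin.
  rewrite /pois (_ : - x = - (x * (1 - z)) + - (x * z)); last by ring.
  by rewrite expRD exprMn; ring.
rewrite nneseriesZl; last by move=> k _; rewrite lee_fin pois_ge0.
by rewrite pois_series1// mule1.
Qed.

Lemma pois_le1 x k : 0 <= x -> pois x k <= 1.
Proof.
move=> x0; apply: le_trans (ptail_le1 k x0).
by rewrite ptailS lerDl ptail_ge0.
Qed.

(** [poisS] bounds the weight by [(k + 1) / x], the next weight being at most 1. *)
Lemma pois_cvgy0 k : pois x k @[x --> +oo] --> (0 : R).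
Proof.
apply: (@squeeze_cvgr _ _ _ _ (cst 0) (fun x => k.+1%:R * x^-1)).
- near=> x; have x0 : 0 < x by near: x; exact: nbhs_pinfty_gt.
  rewrite pois_ge0 ?(ltW x0)//=.
  have -> : pois x k = k.+1%:R * pois x k.+1 * x^-1 by rewrite poisS mulrAC
    mulfV ?mul1r ?gt_eqF.
  by rewrite ler_wpM2r ?invr_ge0 ?(ltW x0)// ler_piMr// pois_le1 ?(ltW x0).
- exact: cvg_cst.
- rewrite -(mulr0 k.+1%:R); apply: cvgMr => //.
  by apply/gtr0_cvgV0; [near=> x; near: x; exact: nbhs_pinfty_gt|exact: cvg_id].
Unshelve. all: by end_near. Qed.

Lemma ptail_cvgy1 n : ptail x n @[x --> +oo] --> (1 : R).
Proof.
elim: n => [|n IH].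
  by under eq_fun do rewrite ptail0; exact: cvg_cst.
rewrite (_ : ptail^~ n.+1 = fun x => ptail x n - pois x n); last first.
  by apply/funext => x; rewrite (ptailS x n); ring.
by rewrite -[X in _ --> X]subr0; apply: cvgB => //; exact: pois_cvgy0.
Qed.

Lemma is_derive_ptail_scale (a u : R) n :
  is_derive u 1 (fun v => ptail (a * v) n.+1) (a * pois (a * u) n).
Proof. by apply: (@is_derive_scale _ (ptail^~ n.+1)); exact: is_derive_ptail.
  Qed.

Lemma continuous_pois_scale (a : R) n : continuous (fun u => pois (a * u) n).
Proof.
move=> u; apply: (@continuous_comp _ _ _ (fun v => a * v) (pois^~ n)).
  by apply: cvgMr; exact: cvg_id.
exact: continuous_pois.
Qed.

(** [a] times the integrand is the derivative of [ptail (a * u) n.+1], which climbs from 0 to 1. The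
    value is the mean time that a Poisson process of rate [a] spends in state [n], the same for all
    [n]. *)
Lemma integral_pois_scaley (a : R) n : 0 < a ->
  (\int[mu]_(u in `[0%R, +oo[) (pois (a * u) n)%:E = (a^-1)%:E)%E.
Proof.
move=> a0.
have h : (\int[mu]_(u in `[0%R, +oo[) (a * pois (a * u) n)%:E = 1%:E)%E.
  rewrite (@integral_itvy_is_derive _ _ _ _ 1 _
    (fun u => is_derive_ptail_scale a u n)).
  - by rewrite mulr0 ptail0l subr0.
  - by move=> x x0; rewrite mulr_ge0 ?pois_ge0 ?mulr_ge0// ltW.
  - by move=> u; apply: cvgMr; exact: continuous_pois_scale.
  - apply: (@cvg_comp _ _ _ (fun v => a * v) (ptail^~ n.+1)).
      exact: gt0_cvgMry.
    exact: ptail_cvgy1.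
have m : measurable_fun (`[0%R, +oo[%classic : set R) (fun u : R => (pois (a *
  u) n)%:E).
  apply: measurable_funTS; apply/measurable_EFinP.
  by apply: continuous_measurable_fun; exact: continuous_pois_scale.
have h2 : (a%:E * \int[mu]_(u in `[0%R, +oo[) (pois (a * u) n)%:E = 1%:E)%E.
  rewrite -ge0_integralZl_EFin ?ltW//.
  by move=> u /=; rewrite in_itv/= andbT => u0; rewrite lee_fin pois_ge0
    ?mulr_ge0// ltW.
have /= := congr1 (fun e => (a^-1)%:E * e)%E h2.
by rewrite muleA -EFinM mulVf ?gt_eqF// mul1e mule1.
Qed.

(** One plus the mean, by the tail-sum formula. Each tail beyond the first is an integral of a
    weight over [[0, x]], and the weights sum to 1 under the integral. *)
Lemma sum_ptail x : 0 <= x -> (\sum_(b <oo) (ptail x b)%:E = (1 + x)%:E)%E.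
Proof.
move=> x0; rewrite nneseriesS; last by move=> k; rewrite lee_fin ptail_ge0.
rewrite ptail0 EFinD; congr (_ + _)%E.
under eq_eseriesr do rewrite -integral_pois0//.
rewrite -integral_nneseries//; last 2 first.
- by move=> n; apply: measurable_funTS; apply/measurable_EFinP; exact:
    measurable_pois.
- by move=> n u /=; rewrite in_itv/= => /andP[u0 _]; rewrite lee_fin pois_ge0.
under eq_integral.
  move=> u; rewrite inE/= in_itv/= => /andP[u0 _]; rewrite pois_series1//; over.
rewrite integral_cst//= lebesgue_measure_itv/= lte_fin mul1e.
case: (ltP 0 x) => [_|x0']; first by rewrite sube0.
by rewrite (@le_anti _ _ x 0)// x0 x0'.
Qed.

Lemma Gamma_natS n : Gamma (n.+1%:R : R) = n`!%:R.
Proof.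
rewrite /Gamma /Rintegral -natr1 addrK.
transitivity (fine (n`!%:R%:E * \int[mu]_(s in `]0%R, +oo[) (pois s n)%:E)).
  congr fine; rewrite -ge0_integralZl_EFin//; last 2 first.
  - by move=> s /=; rewrite in_itv/= andbT => s0; rewrite lee_fin pois_ge0
      ?(ltW s0).
  - by apply: measurable_funTS; apply/measurable_EFinP; exact: measurable_pois.
  apply: eq_integral => s; rewrite inE/= in_itv/= andbT => s0.
  rewrite powR_mulrn ?(ltW s0)// -EFinM; congr EFin; rewrite /pois.
  by field; rewrite pnatr_eq0 -lt0n fact_gt0.
rewrite integral_itv_obnd_cbnd; last first.
  by apply: measurable_funTS; apply/measurable_EFinP; exact: measurable_pois.
have := @integral_pois_scaley 1 n ltr01.
under eq_integral do rewrite mul1r.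
by move=> ->; rewrite invr1 mule1.
Qed.

(** Superposition and thinning: two independent Poisson counts merge into one of rate [c + l], and
    the coefficient is the binomial probability that [k] of the [n + k] events come from the
    first. *)
Lemma pois_mul (c l u : R) k n : c + l != 0 ->
  pois (c * u) k * pois (l * u) n =
  'C(n + k, k)%:R * c ^+ k * l ^+ n / (c + l) ^+ (n + k) *
  pois ((c + l) * u) (n + k).
Proof.
move=> cl; rewrite /pois mulrDl opprD expRD.
have -> : (c * u + l * u) ^+ (n + k) = (c + l) ^+ (n + k) * u ^+ k * u ^+ n.
  by rewrite -mulrDl exprMn -mulrA -exprD (addnC k).
have := bin_fact (leq_addl n k); rewrite addnK => /(congr1 (fun m => m%:R : R)).
rewrite !natrM => <-; rewrite !exprMn.
field.
by rewrite !pnatr_eq0 -!lt0n !fact_gt0 bin_gt0 leq_addl expf_neq0.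
Qed.

(* Negative binomial weights and tails: with [n.+1] successes of probability
   [l / (c + l)] required, the number of failures is [k], resp. exceeds [k]. *)
Definition nbin (c l : R) n k : R :=
  'C(n + k, k)%:R * c ^+ k * l ^+ n.+1 / (c + l) ^+ (n + k).+1.

Definition nbin_tail (c l : R) n k : R :=
  \sum_(i < n.+1) 'C(i + k, k)%:R * c ^+ k.+1 * l ^+ i / (c + l) ^+ (i + k).+1.

(** [nbin_tail] sums over the number [i] of successes that precede failure number [k.+1], the form
    in which the integral of [expectation_ptail_inverse] delivers it. This identity and the next
    show that its successive differences, starting from 1, are the weights [nbin]; both are
    inductions on [n], the second by Pascal's rule. *)
Lemma nbin_tail0 (c l : R) n : c + l != 0 ->
  nbin c l n 0 + nbin_tail c l n 0 = 1.
Proof.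
move=> cl; rewrite /nbin /nbin_tail; elim: n => [|n IH].
  by rewrite big_ord1 !bin0 addn0 !expr1 !expr0 !mul1r; field.
rewrite big_ord_recr/= addrCA -[RHS]IH addrC; congr (_ + _).
rewrite !bin0 !addn0 expr0 !(exprS l) !(exprS (c + l)) expr1.
by field; rewrite expf_neq0.
Qed.

Lemma nbin_tailS (c l : R) n k : c + l != 0 ->
  nbin c l n k.+1 + nbin_tail c l n k.+1 = nbin_tail c l n k.
Proof.
move=> cl; rewrite /nbin /nbin_tail; elim: n => [|n IH].
  rewrite !big_ord1 !add0n !binn !expr0 expr1 (exprS c k.+1) (exprS _ k.+1).
  by field; rewrite expf_neq0.
rewrite big_ord_recr/= [in RHS]big_ord_recr/= -IH addrCA [RHS]addrAC.
rewrite addrC; congr (_ + _).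
rewrite addSn binS natrD !addnS !addSn !(exprS l) !(exprS (c + l)) !(exprS c).
by field; rewrite ?expf_neq0.
Qed.

End poisson_sums.

Section poisson_pair.
Context {R : realType}.
Local Open Scope ereal_scope.

(** Meant for the counts of a Poisson process at two times, which are [a] and [a + b] with [a] and
    [b] independent; [time_changed_product] needs their mixed moment. *)
Lemma pois_pair_moment (x y : R) : (0 <= x)%R -> (0 <= y)%R ->
  \sum_(a <oo) (pois x a)%:E *
    \sum_(b <oo) (pois y b)%:E * (a%:R * (a%:R + b%:R))%:E =
  (x * (x + y) + x)%:E.
Proof.
move=> x0 y0.
have p0 z k : (0 <= z)%R -> 0 <= (pois z k)%:E by move=> z0; rewrite lee_fin
  pois_ge0.
transitivity (\sum_(a <oo) ((pois x a)%:E * (a%:R ^+ 2)%:E + y%:E * ((pois x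
  a)%:E * a%:R%:E))).
  apply: eq_eseriesr => a _.
  transitivity ((pois x a)%:E * (\sum_(b <oo) ((a%:R ^+ 2)%:E * (pois y b)%:E
      + a%:R%:E * ((pois y b)%:E * b%:R%:E)))).
    congr (_ * _); apply: eq_eseriesr => b _.
    by rewrite -!EFinM -EFinD; congr EFin; ring.
  rewrite nneseriesD; last 2 first.
  - by move=> b _ _; rewrite mule_ge0 ?p0// lee_fin exprn_ge0.
  - by move=> b _ _; rewrite !mule_ge0 ?p0// lee_fin.
  rewrite nneseriesZl; last by move=> b _; exact: p0.
  rewrite nneseriesZl; last by move=> b _; rewrite mule_ge0 ?p0// lee_fin.
  rewrite pois_series1// pois_mean// mule1 -!EFinM -!EFinD.
  by congr EFin; ring.
rewrite nneseriesD; last 2 first.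
- by move=> a _ _; rewrite mule_ge0 ?p0// lee_fin exprn_ge0.
- by move=> a _ _; rewrite !mule_ge0 ?p0// lee_fin.
rewrite nneseriesZl; last by move=> a _; rewrite mule_ge0 ?p0// lee_fin.
rewrite pois_moment2// pois_mean// -EFinM -EFinD; congr EFin; ring.
Qed.

End poisson_pair.

(** * Independence and Tonelli *)

(** A measure that factors on rectangles is the product measure, by uniqueness, and Tonelli's
    theorem applies to the latter. *)
Lemma integral_product_law d1 d2 (U1 : measurableType d1)
    (U2 : measurableType d2) (R : realType)
    (m1 : probability U1 R) (m2 : probability U2 R)
    (m : {measure set (U1 * U2) -> \bar R}) (phi : U1 * U2 -> \bar R) :
  (forall A B, measurable A -> measurable B -> m (A `*` B) = m1 A * m2 B)%E ->
  measurable_fun [set: U1 * U2] phi -> (forall z, 0 <= phi z)%E ->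
  (\int[m]_z phi z = \int[m2]_y \int[m1]_x phi (x, y))%E.
Proof.
move=> mE mphi phi0; rewrite -fubini_tonelli// -fubini_tonelli1//.
by apply: eq_measure_integral => A mA _; apply/esym; exact:
  product_measure_unique.
Qed.

Section independence.
Context d (T : measurableType d) (R : realType) (P : probability T R).
Local Open Scope ereal_scope.

Section integral_independent.
Context d1 d2 (U1 : measurableType d1) (U2 : measurableType d2).
Variables (X : {mfun T >-> U1}) (Y : {mfun T >-> U2}).
Hypothesis indep : forall A B, measurable A -> measurable B ->
  P (X @^-1` A `&` Y @^-1` B) = P (X @^-1` A) * P (Y @^-1` B).

Let XY w := (X w, Y w).

Let mXY : measurable_fun [set: T] XY.
Proof. exact: measurable_fun_pair. Qed.

HB.instance Definition _ := @isMeasurableFun.Build _ _ _ _ XY mXY.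

Lemma independent_integral (phi : U1 * U2 -> \bar R) :
  measurable_fun [set: U1 * U2] phi -> (forall z, 0 <= phi z) ->
  \int[P]_w phi (X w, Y w) = \int[P]_w' \int[P]_w phi (X w, Y w').
Proof.
move=> mphi phi0.
rewrite -(@ge0_integral_distribution _ _ _ _ _ P XY _ mphi phi0).
rewrite (integral_product_law (m1 := distribution P X) (m2 := distribution P Y)
  (m := distribution P XY) indep)//.
rewrite ge0_integral_distribution//; last 2 first.
- exact: measurable_fun_fubini_tonelli_G.
- by move=> y; exact: integral_ge0.
apply: eq_integral => w' _ /=; rewrite ge0_integral_distribution//.
exact: measurableT_comp.
Qed.

End integral_independent.

Section tonelli.
Notation mu := (@lebesgue_measure R).

Lemma expectation_integral_swap (D : set R) (psi : T * R -> \bar R) :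
  measurable D -> measurable_fun [set: T * R] psi ->
  (forall w x, D x -> 0 <= psi (w, x)) ->
  \int[P]_w \int[mu]_(x in D) psi (w, x) =
  \int[mu]_(x in D) \int[P]_w psi (w, x).
Proof.
move=> mD mpsi psi0.
(* [psi] is nonnegative over [D] only; extended by 0 outside, it falls under Tonelli's theorem on
   the whole product. *)
pose f := psi \_ ([set: T] `*` D).
have mf : measurable_fun [set: T * R] f.
  by apply/measurable_restrict => //; [exact: measurableX|exact:
    measurable_funTS].
have f0 z : 0 <= f z by apply: erestrict_ge0 => -[w x] [_ /=]; exact: psi0.
transitivity (\int[P]_w \int[mu]_x f (w, x)).
  apply: eq_integral => w _; rewrite integral_mkcond; apply: eq_integral => x _.
  by rewrite /f !patchE in_setX in_setT.
rewrite fubini_tonelli// [RHS]integral_mkcond; apply: eq_integral => x _.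
rewrite patchE /f; case: ifPn => xD.
  by apply: eq_integral => w _; rewrite patchE in_setX in_setT xD.
by apply: integral0_eq => w _; rewrite patchE in_setX in_setT (negbTE xD).
Qed.

Lemma measurable_fun_inner_integral (D : set R) (psi : T * R -> \bar R) :
  measurable D -> measurable_fun [set: T * R] psi ->
  (forall w x, D x -> 0 <= psi (w, x)) ->
  measurable_fun [set: T] (fun w => \int[mu]_(x in D) psi (w, x)).
Proof.
move=> mD mpsi psi0.
pose f := psi \_ ([set: T] `*` D).
have mf : measurable_fun [set: T * R] f.
  by apply/measurable_restrict => //; [exact: measurableX|exact:
    measurable_funTS].
have f0 z : 0 <= f z by apply: erestrict_ge0 => -[w x] [_ /=]; exact: psi0.
apply: eq_measurable_fun (measurable_fun_fubini_tonelli_F (m2 := mu) f mf f0).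
move=> w _; rewrite [RHS]integral_mkcond; apply: eq_integral => x _.
by rewrite /f !patchE in_setX in_setT.
Qed.

(** Tonelli for a random set of times: [C] will say that a sum of jumps is at most [x], or that [x]
    lies before [Y t], and only the probabilities of its sections survive. *)
Lemma expectation_layer (D : set R) (c : R -> \bar R) (C : set (T * R)) :
  measurable D -> measurable_fun [set: R] c -> (forall x, D x -> 0 <= c x) ->
  measurable C ->
  \int[P]_w \int[mu]_(x in D) (c x * (\1_C (w, x))%:E) =
  \int[mu]_(x in D) (c x * P [set w | C (w, x)]).
Proof.
move=> mD mc c0 mC.
rewrite (expectation_integral_swap (psi := fun z => c z.2 * (\1_C z)%:E))//=;
  last 2 first.
- apply: emeasurable_funM; first exact: measurableT_comp.
  by apply/measurable_EFinP; exact: measurable_indic.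
- by move=> w x Dx; rewrite mule_ge0 ?c0// lee_fin.
apply: eq_integral => x /set_mem Dx.
have mCx : measurable [set w | C (w, x)].
  by have := measurable_ysection x mC; rewrite /ysection; congr (measurable _);
    apply/seteqP; split => w /=; rewrite inE.
have indE w : \1_C (w, x) = \1_[set w | C (w, x)] w :> R.
  by rewrite !indicE; congr (_%:R); apply/idP/idP; rewrite !inE.
under eq_integral do rewrite indE.
rewrite ge0_integralZl ?c0//; last by apply/measurable_EFinP; exact:
  measurable_indic.
by rewrite integral_indic// setIT.
Qed.

Lemma integral_bool (b : T -> bool) : measurable [set w | b w] ->
  \int[P]_w ((b w)%:R)%:E = P [set w | b w].
Proof.
move=> mb; rewrite -[in RHS](setIT [set w | b w]) -integral_indic//.
by apply: eq_integral => w _; rewrite indicE mem_setE.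
Qed.

End tonelli.

(* The identity is measurable from [T] to [T] with a smaller sigma-algebra, so
   independence of two sub-sigma-algebras is independence of two copies of it.
     *)
Lemma independent_systems_integral (G1 G2 : set (set T))
    (phi : g_sigma_algebraType G1 * g_sigma_algebraType G2 -> \bar R) :
  <<s G1 >> `<=` measurable -> <<s G2 >> `<=` measurable ->
  independent_systems P <<s G1 >> <<s G2 >> ->
  measurable_fun setT phi -> (forall z, 0 <= phi z) ->
  \int[P]_w phi (w, w) = \int[P]_w' \int[P]_w phi (w, w').
Proof.
move=> mG1 mG2 indep mphi phi0.
pose X (w : T) : g_sigma_algebraType G1 := w.
pose Y (w : T) : g_sigma_algebraType G2 := w.
have mX : measurable_fun setT X by move=> _ A mA; rewrite setTI; exact: mG1.
have mY : measurable_fun setT Y by move=> _ A mA; rewrite setTI; exact: mG2.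
pose X' : {mfun T >-> g_sigma_algebraType G1} := mfun_Sub (mem_set mX).
pose Y' : {mfun T >-> g_sigma_algebraType G2} := mfun_Sub (mem_set mY).
by rewrite (@independent_integral _ _ _ _ X' Y').
Qed.

End independence.

(** * Sigma-algebras generated by processes, and grouping of independent families *)

Section process_sigma_algebras.
Context d (T : measurableType d) (R : realType) (P : probability T R).

Lemma process_sigma_preimage d' (U : measurableType d') (I : Type)
    (D : set I) (X : I -> T -> U) i B :
  D i -> measurable B -> process_sigma D X (X i @^-1` B).
Proof.
move=> Di mB; apply: sub_sigma_algebra; exists i => //.
by exists B => //; rewrite setTI.
Qed.

Lemma process_sigma_measurable d' (U : measurableType d') (I : Type)
    (D : set I) (X : I -> T -> U) :
  (forall i, D i -> measurable_fun setT (X i)) ->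
  process_sigma D X `<=` measurable.
Proof.
move=> mX; apply: smallest_sub; first exact: sigma_algebra_measurable.
by move=> _ [i Di [B mB <-]]; exact: mX.
Qed.

Section grouping.
Context d' (U : measurableType d') (I : choiceType) (X : I -> T -> U).
Hypothesis mX : forall i, measurable_fun setT (X i).
Local Open Scope ereal_scope.

(** Finite-dimensional events form a pi-system that generates [process_sigma D X], and mutual
    independence speaks of these events. *)
Let cylinders (D : set I) : set (set T) :=
  [set A | exists (J : {fset I}) (B : I -> set U),
    [/\ [set` J] `<=` D, forall i, measurable (B i) &
        A = \bigcap_(i in [set` J]) (X i @^-1` B i)]].

Let cylinders_setI D : setI_closed (cylinders D).
Proof.
move=> _ _ [J [B [JD mB ->]]] [K [C [KD mC ->]]].
pose E i := (if i \in J then B i else setT) `&` (if i \in K then C i else setT).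
exists (J `|` K)%fset, E; split.
- by move=> i /=; rewrite in_fsetU => /orP[/JD|/KD].
- by move=> i; apply: measurableI; case: ifP.
apply/seteqP; split=> w.
  move=> [wB wC] i /= _; split; case: ifPn => // iJ; [exact: wB|exact: wC].
move=> wE; split=> i /= iJ.
  by have [] := wE i; rewrite /= ?in_fsetU iJ.
by have [] := wE i; rewrite /= ?in_fsetU iJ ?orbT//.
Qed.

Let cylinders_measurable D : cylinders D `<=` measurable.
Proof.
move=> _ [J [B [_ mB ->]]]; apply: fin_bigcap_measurable => [|i _].
  exact: finite_fset.
by rewrite -[X in measurable X]setTI; exact: mX.
Qed.

Let cylindersT D : cylinders D setT.
Proof.
exists fset0, (fun=> setT); split => //.
by apply/seteqP; split => // w _ i.
Qed.

Let cylinders_process_sigma D : process_sigma D X `<=` <<s cylinders D >>.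
Proof.
apply: smallest_sub; first exact: smallest_sigma_algebra.
move=> _ [i Di [B mB <-]]; apply: sub_sigma_algebra.
exists [fset i]%fset, (fun=> B); split => //.
  by move=> j /=; rewrite inE => /eqP ->.
rewrite setTI; apply/seteqP; split => [w wB j /=|w].
  by rewrite inE => /eqP ->.
by apply; rewrite /= inE.
Qed.

Let cylinders_indep D1 D2 : D1 `&` D2 = set0 ->
  mutually_independent P X -> independent_systems P (cylinders D1) (cylinders
    D2).
Proof.
move=> D12 iX _ _ [J [B [JD mB ->]]] [K [C [KD mC ->]]].
have JK i : i \in J -> i \in K -> False.
  by move=> /JD D1i /KD D2i; suff: set0 i by []; rewrite -D12.
(* The index sets are disjoint, so one family can carry both [B] and [C]. *)
pose E i := if i \in J then B i else C i.
have mE i : measurable (E i) by rewrite /E; case: ifP.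
have pJK : perm_eq (J `|` K)%fset (J ++ K).
  apply: uniq_perm; rewrite ?fset_uniq ?cat_uniq ?fset_uniq//=.
    by rewrite andbT; apply/hasPn => i /= iK; apply/negP => iJ; exact: (JK i).
  by move=> i; rewrite in_fsetU mem_cat.
have -> : \bigcap_(i in [set` J]) (X i @^-1` B i) `&`
    \bigcap_(i in [set` K]) (X i @^-1` C i) =
    \bigcap_(i in [set` (J `|` K)%fset]) (X i @^-1` E i).
  apply/seteqP; split=> w.
    move=> [wB wC] i /=; rewrite in_fsetU /E => iJK.
    by case: ifPn iJK => [iJ _|_ /= iK]; [exact: wB|exact: wC].
  move=> wE; split=> i /= iJ.
    by have := wE i; rewrite /= in_fsetU /E iJ; exact.
  have := wE i; rewrite /= in_fsetU /E iJ orbT => /(_ isT).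
  by case: ifPn => // /JK/(_ iJ).
rewrite !iX// (perm_big _ pJK) big_cat/=; congr (_ * _).
  by apply: eq_big_seq => i iJ; rewrite /E iJ.
by apply: eq_big_seq => i iK; rewrite /E; case: ifPn => // /JK/(_ iK).
Qed.

(** Two passes of the uniqueness theorem for measures on a pi-system: first a cylinder [A] is fixed
    and [B] varies, then [B] is fixed in the whole sigma-algebra and [A] varies. *)
Lemma mutually_independent_process_sigma D1 D2 : D1 `&` D2 = set0 ->
  mutually_independent P X ->
  independent_systems P (process_sigma D1 X) (process_sigma D2 X).
Proof.
move=> D12 iX.
have mD D : <<s cylinders D >> `<=` measurable.
  by apply: smallest_sub; [exact: sigma_algebra_measurable|exact:
    cylinders_measurable].
have indep1 A B : cylinders D1 A -> <<s cylinders D2 >> B ->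
    P (A `&` B) = P A * P B.
  move=> cA sB; have mA := cylinders_measurable cA.
  (* The measures compared are [P] restricted to [A] and [P] scaled by [P A]; scaling takes a
     nonnegative real, hence [r]. *)
  pose r : {nonneg R} := NngNum (fine_ge0 (measure_ge0 P A)).
  have PA : r%:num%:E = P A by rewrite /= fineK// fin_num_measure.
  rewrite setIC -PA.
  apply: (@g_sigma_algebra_measure_unique _ _ _ (cylinders D2)
    (@cylinders_measurable D2) (fun=> setT) _ _ (mrestr P mA) (mscale r P)) =>
      //.
  - by rewrite bigcup_const.
  - move=> C cC; rewrite -[LHS]/(P (C `&` A)) -[RHS]/(r%:num%:E * P C) setIC PA.
    exact: (cylinders_indep D12 iX).
  - by move=> _; rewrite -ge0_fin_numE//; exact: fin_num_measure (measurableI _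
      _ measurableT _).
move=> A B /cylinders_process_sigma sA /cylinders_process_sigma sB.
have mB := mD _ _ sB.
pose r : {nonneg R} := NngNum (fine_ge0 (measure_ge0 P B)).
have PB : r%:num%:E = P B by rewrite /= fineK// fin_num_measure.
rewrite muleC -PB.
apply: (@g_sigma_algebra_measure_unique _ _ _ (cylinders D1)
    (@cylinders_measurable D1) (fun=> setT) _ _ (mrestr P mB) (mscale r P)) =>
      //.
- by rewrite bigcup_const.
- by move=> C cC; rewrite -[LHS]/(P (C `&` B)) -[RHS]/(r%:num%:E * P C) PB
    muleC indep1.
- by move=> _; rewrite -ge0_fin_numE//; exact: fin_num_measure (measurableI _ _
    measurableT _).
Qed.

End grouping.
End process_sigma_algebras.

(** * Sums of exponential variables *)

Lemma set_andb (T : Type) (p q : T -> bool) :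
  [set w | p w && q w] = [set w | p w] `&` [set w | q w].
Proof. by apply/seteqP; split=> w /=; [move/andP|move=> ?; exact/andP]. Qed.

Section nat_partition.
Context d (T : measurableType d) (R : realType) (P : {measure set T -> \bar R}).
Local Open Scope ereal_scope.

Lemma measurable_fun_nat_comp d' (U : measurableType d') (A : T -> nat)
    (g : nat -> T -> U) : measurable_fun setT A ->
  (forall a, measurable_fun setT (g a)) ->
  measurable_fun setT (fun w => g (A w) w).
Proof.
move=> mA mg _ B mB; rewrite setTI.
rewrite (_ : _ @^-1` B = \bigcup_a (A @^-1` [set a] `&` g a @^-1` B)).
  apply: bigcup_measurable => a _; apply: measurableI.
    by rewrite -[X in measurable X]setTI; exact: mA.
  by rewrite -[X in measurable X]setTI; exact: mg.
by apply/seteqP; split=> [w gB|w [a _ [/= <-]]//]; exists (A w).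
Qed.

Lemma integral_nat_partition (D : set T) (A : T -> nat) (g : nat -> T -> \bar
  R) :
  measurable D -> measurable_fun setT A ->
  (forall a, measurable_fun setT (g a)) -> (forall a w, 0 <= g a w) ->
  \int[P]_(w in D) g (A w) w =
  \sum_(a <oo) \int[P]_(w in D `&` A @^-1` [set a]) g a w.
Proof.
move=> mD mA mg g0.
have mAa a : measurable (A @^-1` [set a]).
  by rewrite -[X in measurable X]setTI; exact: mA.
have DE : D = \bigcup_a (D `&` A @^-1` [set a]).
  by apply/seteqP; split=> [w Dw|w [a _ []//]]; exists (A w).
rewrite [in LHS]DE ge0_integral_bigcup//.
- apply: eq_eseriesr => a _; apply: eq_integral => w.
  by rewrite inE => -[_ /= ->].
- by move=> a; exact: measurableI.
- by apply: measurable_funTS; exact: measurable_fun_nat_comp.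
- by move=> a b _ _ [w [[_ /= <-] [_ /= <-]]].
Qed.

Lemma measure_nat_partition (D : set T) (A : T -> nat) :
  measurable D -> measurable_fun setT A ->
  P D = \sum_(a <oo) P (D `&` A @^-1` [set a]).
Proof.
move=> mD mA; have := @integral_nat_partition D A (fun _ _ => 1) mD mA.
rewrite integral_cst// mul1e => -> //.
apply: eq_eseriesr => a _; rewrite integral_cst ?mul1e//.
by apply: measurableI => //; rewrite -[X in measurable X]setTI; exact: mA.
Qed.

End nat_partition.

Section layer.
Context {R : realType}.
Notation mu := (@lebesgue_measure R).
Local Open Scope ereal_scope.

Lemma integral_itv_from (F f : R -> R) (s y : R) : (0 <= y)%R ->
  (forall x : R, is_derive x 1%R F (f x)) -> continuous f ->
  \int[mu]_(x in `[0%R, s]) ((f x)%:E * ((y <= x)%R%:R)%:E) =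
  ((y <= s)%R%:R * (F s - F y)%R)%:E.
Proof.
move=> y0 dF cf.
transitivity (\int[mu]_(x in `[0%R, s] `&` `[y, +oo[) (f x)%:E).
  rewrite integral_mkcondr; apply: eq_integral => x _; rewrite patchE mem_setE
    in_itv/= andbT.
  by case: (y <= x)%R; rewrite ?mule1 ?mule0.
case: (leP y s) => [ys|sy].
  rewrite mul1r -(integral_itv_is_derive ys dF cf); congr (integral _ _ _).
  apply/seteqP; split=> x /=; rewrite !in_itv/= ?andbT.
    by move=> [/andP[_ ->] ->].
  by move=> /andP[yx ->]; rewrite yx (le_trans y0 yx).
rewrite mul0r (_ : _ `&` _ = set0) ?integral_set0//.
apply/seteqP; split=> x //=; rewrite !in_itv/= andbT => -[/andP[_ xs] yx].
by move: (le_lt_trans (le_trans yx xs) sy); rewrite ltxx.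
Qed.

Lemma integral_itvy_below (F f : R -> R) (y : R) : (0 <= y)%R ->
  (forall x : R, is_derive x 1%R F (f x)) -> continuous f ->
  \int[mu]_(x in `[0%R, +oo[) ((f x)%:E * ((x < y)%R%:R)%:E) =
  (F y - F 0)%:E.
Proof.
move=> y0 dF cf.
transitivity (\int[mu]_(x in `[0%R, +oo[ `&` `]-oo, y[) (f x)%:E).
  rewrite integral_mkcondr; apply: eq_integral => x _; rewrite patchE mem_setE
    in_itv/=.
  by case: (x < y)%R; rewrite ?mule1 ?mule0.
rewrite -(integral_itv_is_derive y0 dF cf).
rewrite (_ : _ `&` _ = `[0%R, y[%classic); last first.
  by apply/seteqP; split=> x /=; rewrite !in_itv/= andbT => /andP.
rewrite integral_itv_bndo_bndc//.
by apply: measurable_funTS; apply/measurable_EFinP; exact: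
  continuous_measurable_fun.
Qed.

End layer.

Section exponential_sums.
Context d (T : measurableType d) (R : realType) (P : probability T R).
Variables (beta : R) (xi : nat -> {RV P >-> R}).
Hypothesis beta_gt0 : 0 < beta.
Hypothesis independent_xi : mutually_independent P (fun j => xi j : T -> R).
Hypothesis exponential_xi : forall (j : nat) (A : set R), measurable A ->
  distribution P (xi j) A = exponential_prob beta A.
Notation mu := (@lebesgue_measure R).

(** The starting index is kept because independence is used between disjoint blocks of jumps, as
    they arise from [bsumD]. *)
Definition bsum m n (w : T) : R := \sum_(j < n) xi (m + j)%N w.

Lemma bsum0 m w : bsum m 0 w = 0.
Proof. by rewrite /bsum big_ord0. Qed.

Lemma bsumS m n w : bsum m n.+1 w = bsum m n w + xi (m + n)%N w.
Proof. by rewrite /bsum big_ord_recr. Qed.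

Lemma bsumD a b w : bsum 0 (a + b) w = bsum 0 a w + bsum a b w.
Proof. by rewrite /bsum big_split_ord. Qed.

Lemma measurable_bsum m n : measurable_fun setT (bsum m n).
Proof. by apply: measurable_sum => j; exact: measurable_funP. Qed.

(** The sum is measurable already for the sigma-algebra generated by the jumps with index in [D], so
    measurability is checked on [T] equipped with it. *)
Lemma bsum_process_sigma (D : set nat) m n B :
  [set i | (m <= i < m + n)%N] `<=` D -> measurable B ->
  process_sigma D (fun j => xi j : T -> R) (bsum m n @^-1` B).
Proof.
move=> mnD mB.
pose G := \bigcup_(i in D)
  preimage_set_system setT (xi i : T -> R) measurable.
have : measurable_fun (setT : set (g_sigma_algebraType G)) (bsum m n :
  g_sigma_algebraType G -> R).
  apply: measurable_sum => j _ C mC; rewrite setTI.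
  apply: (@process_sigma_preimage _ _ _ _ _ _ (fun j => xi j : T -> R)) => //=.
  by apply: mnD; rewrite /= leq_addr ltn_add2l ltn_ord.
by move=> /(_ measurableT B mB); rewrite setTI.
Qed.

Lemma indep_bsum (i j k l : nat) A B :
  [set x | (i <= x < i + j)%N] `&` [set x | (k <= x < k + l)%N] = set0 ->
  measurable A -> measurable B ->
  P (bsum i j @^-1` A `&` bsum k l @^-1` B) =
  (P (bsum i j @^-1` A) * P (bsum k l @^-1` B))%E.
Proof.
move=> D mA mB.
by apply: (mutually_independent_process_sigma _ D independent_xi);
  [move=> x; exact: measurable_funP|exact: bsum_process_sigma..].
Qed.

Lemma exponential_lt0 j : P [set w | xi j w < 0] = 0%E.
Proof.
have := exponential_xi j (measurable_itv `]-oo, 0[).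
rewrite /distribution /pushforward/= /exponential_prob.
rewrite [RHS]integral0_eq; last first.
  by move=> x /=; rewrite in_itv/= => x0; rewrite lt0_exponential_pdf.
by move=> <-; congr (P _); apply/seteqP; split=> w /=; rewrite in_itv.
Qed.

Lemma exponential_cdf j t : 0 <= t ->
  P [set w | xi j w <= t] = (1 - expR (- (beta * t)))%:E.
Proof.
move=> t0; have := exponential_xi j (measurable_itv `]-oo, t]).
rewrite /distribution /pushforward/= => h.
rewrite (_ : [set w | _] = xi j @^-1` `]-oo, t]); last first.
  by apply/seteqP; split=> w /=; rewrite in_itv.
rewrite h /exponential_prob.
rewrite (_ : `]-oo, t]%classic = `]-oo, 0[ `|` `[0, t]); last first.
  apply/seteqP; split=> x /=; rewrite !in_itv/=.
    by move=> xt; case: (ltP x 0) => x0; [left|right].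
  by move=> [x0|/andP[]//]; exact: le_trans (ltW x0) t0.
rewrite ge0_integral_setU//=; last 3 first.
- by apply: measurable_funTS; apply/measurable_EFinP; exact:
    measurable_exponential_pdf.
- by move=> x _; rewrite lee_fin exponential_pdf_ge0// ltW.
- apply/disj_setPS => x [/=]; rewrite !in_itv/= => x0 /andP[x0' _].
  by move: (lt_le_trans x0 x0'); rewrite ltxx.
rewrite integral0_eq ?add0e; last first.
  by move=> x /=; rewrite in_itv/= => x0; rewrite lt0_exponential_pdf.
move: t0; rewrite le_eqVlt => /predU1P[<-|t0].
  by rewrite set_itv1 integral_set1 mulr0 oppr0 expR0 subrr.
by have := exponential_prob_itv0c beta t0; rewrite /exponential_prob => ->;
  rewrite mulNr.
Qed.

Lemma xi_ge0_ae : {ae P, forall w, forall j, 0 <= xi j w}.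
Proof.
apply/ae_foralln => j; exists [set w | xi j w < 0]; split.
- rewrite (_ : [set w | _] = xi j @^-1` `]-oo, 0[); first exact:
    measurable_funPTI.
  by apply/seteqP; split=> w /=; rewrite in_itv.
- exact: exponential_lt0.
- by move=> w /= /negP; rewrite -ltNge.
Qed.

Local Open Scope ereal_scope.

Lemma bsum_ge0_ae : {ae P, forall w, forall m n, (0 <= bsum m n w)%R}.
Proof.
apply: filterS xi_ge0_ae => w xi0 m n.
by apply: sumr_ge0 => j _; exact: xi0.
Qed.

Lemma measurable_bsum_le m n : measurable [set z : T * R | (bsum m n z.1 <=
  z.2)%R].
Proof.
have : measurable_fun setT (fun z : T * R => (bsum m n z.1 <= z.2)%R).
  apply: measurable_fun_ler => //.
  exact: measurableT_comp (measurable_bsum m n) _.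
by move=> /(_ measurableT [set true]); rewrite setTI; exact.
Qed.

Lemma measurable_bsum_le1 m n t : measurable [set w | (bsum m n w <= t)%R].
Proof.
rewrite (_ : [set w | _] = bsum m n @^-1` `]-oo, t]).
  by rewrite -[X in measurable X]setTI; exact: measurable_bsum.
by apply/seteqP; split=> w /=; rewrite in_itv.
Qed.

(* Writing [F s - F y] as the integral of [f] over [y, s], only the distribution
   function of the sum enters. *)
Lemma expectation_bsum_from m n (F f : R -> R) (s : R) :
  (forall x, (0 <= x <= s)%R -> 0 <= f x)%R ->
  (forall x : R, is_derive x 1%R F (f x)) -> continuous f ->
  \int[P]_w ((bsum m n w <= s)%R%:R * (F s - F (bsum m n w)))%:E =
  \int[mu]_(x in `[0%R, s]) ((f x)%:E * P [set w | (bsum m n w <= x)%R]).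
Proof.
move=> f0 dF cf.
have mf : measurable_fun [set: R] (EFin \o f).
  by apply/measurable_EFinP; exact: continuous_measurable_fun.
have f0' x : x \in `[0%R, s] -> 0 <= (EFin \o f) x.
  by rewrite in_itv/= => xs; rewrite lee_fin f0.
rewrite -(expectation_layer P (measurable_itv `[0%R, s]) mf f0'
  (measurable_bsum_le m n)).
apply: ae_eq_integral => //.
- have mb := measurable_bsum m n.
  apply/measurable_EFinP; apply: measurable_funM.
    by apply: measurableT_comp => //; exact: measurable_fun_ler.
  apply: measurable_funB => //; apply: measurableT_comp => //.
  by apply: continuous_measurable_fun; exact: is_derive1_continuous dF.
- apply: (@measurable_fun_inner_integral _ _ _ _ (fun z => (f z.2)%:E *
    (\1_[set z : T * R | (bsum m n z.1 <= z.2)%R] z)%:E)) => //.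
  + apply: emeasurable_funM.
      exact: (measurableT_comp mf).
    by apply/measurable_EFinP; apply: measurable_indic; exact:
      measurable_bsum_le.
  + by move=> w x /=; rewrite in_itv/= => xs; rewrite mule_ge0 ?lee_fin// f0.
apply: filterS bsum_ge0_ae => w b0 _.
rewrite -(integral_itv_from s (b0 m n) dF cf); apply: eq_integral => x _.
by rewrite /= indicE mem_setE.
Qed.

(** Induction on [n] by conditioning on the first [n] jumps: given their sum [S <= t], the next jump
    stays within [t - S] with probability [1 - exp(-beta (t - S))], that is [F t - F S] with
    [F x = exp(-beta (t - x))]. [expectation_bsum_from] then involves only the distribution function
    known by induction. *)
Lemma bsum_cdf m n t : (0 <= t)%R ->
  P [set w | (bsum m n w <= t)%R] = (ptail (beta * t) n)%:E.
Proof.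
elim: n t => [|n IH] t t0.
  under eq_set do rewrite bsum0.
  by rewrite t0 ptail0 set_true probability_setT.
pose phi (z : R * R) : \bar R := ((z.2 + z.1 <= t)%R%:R)%:E.
have mphi : measurable_fun [set: R * R] phi.
  apply/measurable_EFinP; apply: measurableT_comp => //.
  by apply: measurable_fun_ler => //; exact: measurable_funD.
have xiE : (xi (m + n)%N : T -> R) = bsum (m + n) 1.
  by apply/funext => w; rewrite bsumS bsum0 add0r addn0.
pose B : {RV P >-> R} := mfun_Sub (mem_set (measurable_bsum m n)).
have mx (x : R) : measurable [set w | (xi (m + n)%N w <= x)%R].
  by have := measurable_bsum_le1 (m + n) 1 x; rewrite -xiE.
transitivity (\int[P]_w phi (xi (m + n)%N w, B w)).
  rewrite -integral_bool; last exact: measurable_bsum_le1.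
  by apply: eq_integral => w _; rewrite /phi/= bsumS.
rewrite independent_integral//; last 2 first.
- move=> A C mA mC; rewrite /= xiE; apply: indep_bsum => //.
  apply/seteqP; split=> x //= [/andP[h1 _] /andP[_ h2]].
  by move: (leq_trans h2 h1); rewrite ltnn.
- by move=> z; rewrite lee_fin.
pose F (x : R) := expR (- (beta * (t - x))).
pose f (x : R) := (beta * expR (- (beta * (t - x))))%R.
have dF (x : R) : is_derive x 1%R F (f x).
  have h : is_derive x 1%R (fun x : R => - (beta * (t - x)) : R)%R beta.
    by apply: is_derive_eq; rewrite /GRing.scale/=; ring.
  apply: (is_derive_eq (@is_derive1_comp _ expR _ _ _ _ (is_derive_expR _) h)).
  by rewrite /f mulrC.
have cF := is_derive1_continuous dF.
have cf : continuous f by move=> x; apply: cvgMr; exact: cF.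
transitivity (\int[P]_w ((bsum m n w <= t)%R%:R * (F t - F (bsum m n w)))%:E).
  apply: eq_integral => w' _.
  rewrite (_ : \int[P]_w _ = P [set w | (xi (m + n)%N w <= t - bsum m n
    w')%R]); last first.
    rewrite -integral_bool//; apply: eq_integral => w _.
    by rewrite /phi/= lerBrDl.
  case: (leP (bsum m n w') t) => bt.
    by rewrite exponential_cdf ?subr_ge0// /F subrr mulr0 oppr0 expR0 mul1r.
  (* Here the next jump would have to be negative, a null event. *)
  rewrite mul0r; apply/eqP; rewrite eq_le measure_ge0 andbT.
  rewrite -[leRHS](exponential_lt0 (m + n)); apply: le_measure.
  - by rewrite inE.
  - rewrite inE (_ : [set w | _] = xi (m + n)%N @^-1` `]-oo, 0%R[); first
      exact: measurable_funPTI.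
    by apply/seteqP; split=> w /=; rewrite in_itv.
  - by move=> w /= /le_lt_trans; apply; rewrite subr_lt0.
rewrite (expectation_bsum_from _ _ _ dF cf); last first.
  by move=> x _; rewrite mulr_ge0// ltW.
under eq_integral.
  move=> x; rewrite inE/= in_itv/= => /andP[x0 _]; rewrite IH// -EFinM; over.
(* As [f = beta F], the product rule gives [f (ptail n.+1 + pois n) = f ptail n], the integrand left
   by the induction hypothesis. *)
have dG (x : R) : is_derive x 1%R (fun x : R => F x * ptail (beta * x) n.+1 :
  R)%R
    (f x * ptail (beta * x) n)%R.
  have h := is_deriveM (dF x) (is_derive_ptail_scale beta x n).
  apply: (is_derive_eq h); rewrite /GRing.scale/= [in RHS]ptailS /f /F.
  by ring.
rewrite (@integral_itv_is_derive _ _ _ 0%R t t0 dG).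
  by rewrite /F subrr mulr0 oppr0 expR0 mul1r ptail0l mulr0 subr0.
move=> x; apply: cvgM; first exact: cf.
case: n {IH mphi xiE B mx dG} => [|n].
  have -> : (fun u => ptail (beta * u) 0) = cst 1%R by apply/funext => y;
    rewrite ptail0.
  by rewrite ptail0; exact: cvg_cst.
by have := is_derive1_continuous (fun u => is_derive_ptail_scale beta u n);
  exact.
Qed.

Let ptail_beta_ge0 t n : (0 <= t)%R -> (0 <= ptail (beta * t) n)%R.
Proof. by move=> t0; rewrite ptail_ge0// mulr_ge0// ltW. Qed.

Lemma sum_bsum_cdf t : (0 <= t)%R ->
  \sum_(a <oo) P [set w | (bsum 0 a w <= t)%R] = (1 + beta * t)%:E.
Proof.
move=> t0; rewrite -sum_ptail ?mulr_ge0 ?(ltW beta_gt0)//.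
by apply: eq_eseriesr => a _; rewrite bsum_cdf.
Qed.

(** Conditioning on [S = bsum 0 a], the next [b] jumps being independent of it. The truncation by
    [Num.max 0] acts only where [S > t], hence where the indicator vanishes; it keeps the integrand
    nonnegative, so that the sum over [b] passes under the integral. *)
Let pair_prob a b s t : (s <= t)%R ->
  P [set w | ((bsum 0 a w <= s) && (bsum 0 (a + b) w <= t))%R] =
  \int[P]_w ((bsum 0 a w <= s)%R%:R%:E *
             (ptail (beta * Num.max 0 (t - bsum 0 a w)) b)%:E).
Proof.
move=> st.
pose A : {RV P >-> R} := mfun_Sub (mem_set (measurable_bsum 0 a)).
pose B : {RV P >-> R} := mfun_Sub (mem_set (measurable_bsum a b)).
pose phi (z : R * R) : \bar R := (((z.2 <= s) && (z.2 + z.1 <= t))%R%:R)%:E.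
have mphi : measurable_fun [set: R * R] phi.
  apply/measurable_EFinP; apply: measurableT_comp => //; apply: measurable_and.
    by apply: measurable_fun_ler.
  by apply: measurable_fun_ler => //; exact: measurable_funD.
transitivity (\int[P]_w phi (B w, A w)).
  rewrite -integral_bool; last first.
    by rewrite set_andb; apply: measurableI; exact: measurable_bsum_le1.
  by apply: eq_integral => w _; rewrite /phi/= bsumD.
rewrite independent_integral//; last 2 first.
- move=> C E mC mE; apply: indep_bsum => //.
  apply/seteqP; split=> x //= [/andP[h1 _]].
  by rewrite add0n => h2; move: (leq_trans h2 h1); rewrite ltnn.
- by move=> z; rewrite lee_fin.
apply: eq_integral => w' _; rewrite /phi/=.
case: (leP (bsum 0 a w') s) => as_; last by rewrite mul0e integral0.
have at0 : (0 <= t - bsum 0 a w')%R by rewrite subr_ge0 (le_trans as_).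
rewrite mul1e max_r// -(bsum_cdf a)// -integral_bool; last exact:
  measurable_bsum_le1.
by apply: eq_integral => w _; rewrite lerBrDl.
Qed.

(* Summing over [b] first turns the probabilities into the mean of
   [1 + beta * (t - S_a)] on [S_a <= s], where [S_a = bsum 0 a]. *)
Lemma renewal_pair s t : (0 <= s)%R -> (s <= t)%R ->
  \sum_(a <oo) \sum_(b <oo)
    P [set w | ((bsum 0 a w <= s) && (bsum 0 (a + b) w <= t))%R] =
  ((1 + beta * s) * (1 + beta * (t - s)) + beta * s + (beta * s) ^+ 2 / 2)%:E.
Proof.
move=> s0 st.
have bs0 : (0 <= beta * (t - s))%R by rewrite mulr_ge0 ?(ltW beta_gt0)//
  subr_ge0.
have beta0 := ltW beta_gt0.
transitivity (\sum_(a <oo) ((1 + beta * (t - s))%:E * P [set w | (bsum 0 a w <=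
  s)%R]
  + \int[mu]_(x in `[0%R, s]) (beta%:E * P [set w | (bsum 0 a w <= x)%R]))).
  apply: eq_eseriesr => a _.
  under eq_eseriesr do rewrite pair_prob//.
  have m1 : measurable_fun setT (fun w => (bsum 0 a w <= s)%R%:R : R).
    by apply: measurableT_comp => //; apply: measurable_fun_ler => //; exact:
      measurable_bsum.
  rewrite -integral_nneseries//; last 2 first.
  - move=> n; apply: emeasurable_funM; first exact/measurable_EFinP.
    apply/measurable_EFinP/(measurableT_comp (measurable_ptail n)).
    apply: measurable_funM => //; apply: measurable_maxr => //.
    by apply: measurable_funB => //; exact: measurable_bsum.
  - by move=> n w _; rewrite mule_ge0// lee_fin ptail_beta_ge0// le_max lexx.
  (* [1 + beta (t - S)] is split into [1 + beta (t - s)] and [beta (s - S)]: the second part has the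
     shape [F s - F S] that [expectation_bsum_from] accepts. *)
  transitivity (\int[P]_w ((1 + beta * (t - s))%:E * (bsum 0 a w <= s)%R%:R%:E
     + ((bsum 0 a w <= s)%R%:R * (beta * s - beta * bsum 0 a w))%:E)).
    apply: eq_integral => w _; rewrite nneseriesZl; last first.
      by move=> n _; rewrite lee_fin ptail_beta_ge0// le_max lexx.
    rewrite sum_ptail; last by rewrite mulr_ge0// le_max lexx.
    case: (leP (bsum 0 a w) s) => as_.
      rewrite mul1e mule1 mul1r -EFinD max_r ?subr_ge0 ?(le_trans as_)//.
      by congr EFin; ring.
    by rewrite mul0e mule0 mul0r adde0.
  rewrite ge0_integralD//.
  - rewrite ge0_integralZl//; last 2 first.
    + exact/measurable_EFinP.
    + by rewrite lee_fin addr_ge0.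
    rewrite integral_bool; last exact: measurable_bsum_le1.
    congr (_ + _).
    have dF (x : R) : is_derive x 1%R (fun x : R => beta * x : R)%R (cst beta
      x).
      by apply: is_derive_eq; rewrite /GRing.scale/= mulr1.
    rewrite -(expectation_bsum_from _ _ _ dF)//.
    by move=> x; exact: cvg_cst.
  - by move=> w _; rewrite mule_ge0// lee_fin addr_ge0.
  - apply: emeasurable_funM => //; exact/measurable_EFinP.
  - move=> w _; rewrite lee_fin; case: (leP (bsum 0 a w) s) => // as_; last by
      rewrite mul0r.
    by rewrite mul1r subr_ge0 ler_wpM2l.
  - apply/measurable_EFinP; apply: measurable_funM => //.
    by apply: measurable_funB => //; apply: measurable_funM => //; exact:
      measurable_bsum.
rewrite nneseriesD; last 2 first.
- by move=> a _ _; rewrite mule_ge0// lee_fin addr_ge0.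
- by move=> a _ _; apply: integral_ge0 => x _; rewrite mule_ge0.
rewrite nneseriesZl// sum_bsum_cdf//.
rewrite -integral_nneseries//; last 2 first.
- move=> n; apply: (eq_measurable_fun (fun x => (beta * ptail (beta * x)
    n)%:E)).
    by move=> x; rewrite inE/= in_itv/= => /andP[x0 _]; rewrite bsum_cdf.
  apply: measurable_funTS; apply/measurable_EFinP; apply: measurable_funM => //.
  apply: (measurableT_comp (measurable_ptail n)).
  exact: measurable_funM.
- by move=> n x _; rewrite mule_ge0.
under eq_integral.
  move=> x; rewrite inE/= in_itv/= => /andP[x0 _]; rewrite nneseriesZl//
    sum_bsum_cdf// -EFinM; over.
have dQ (x : R) : is_derive x 1%R
    (fun x : R => beta * x + (beta * x) ^+ 2 / 2 : R)%R (beta * (1 + beta *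
      x))%R.
  have h (y : R) : is_derive y 1%R (fun y : R => y + y ^+ 2 / 2 : R)%R (1 +
    y)%R.
    by apply: is_derive_eq; rewrite /GRing.scale/=; field.
  exact: (is_derive_scale (h (beta * x)%R)).
rewrite (integral_itv_is_derive s0 dQ).
  by rewrite -EFinM -EFinD; congr EFin; field.
move=> x; apply: cvgMr; apply: cvgD; first exact: cvg_cst.
by apply: cvgMr; exact: cvg_id.
Qed.

End exponential_sums.

(** * Poisson processes *)

Section poisson_process_theory.
Context d (T : measurableType d) (R : realType) (P : probability T R).
Variables (lam : R) (N : R -> T -> nat).
Hypothesis lam_gt0 : 0 < lam.
Hypothesis poisson_N : poisson_process P lam N.
Local Open Scope ereal_scope.

Lemma pp_locally_constant w u : (0 <= u)%R ->
  exists2 e : R, (0 < e)%R & forall x, (u <= x)%R -> (x < u + e)%R -> N x w = N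
    u w.
Proof.
move=> u0; have /(_ [set N u w]) := @pp_right_continuous _ _ _ _ _ _ poisson_N
  w u u0.
have nb : nbhs (N u w) [set N u w] by [].
move=> /(_ nb) [e /= e0 he]; exists e => // x ux xue.
have [<-//|xu] := eqVneq u x.
have {xu}ux' : (u < x)%R by rewrite lt_neqAle xu.
by apply: he => //; rewrite /= ltr0_norm ?subr_lt0// opprB ltrBlDl.
Qed.

Lemma pp_increment_law u v k : (0 <= u)%R -> (u <= v)%R ->
  P [set w | (N v w - N u w)%N = k] = (pois (lam * (v - u)) k)%:E.
Proof.
move=> u0; rewrite le_eqVlt => /predU1P[<-|uv].
  rewrite subrr mulr0 pois0l; under eq_set do rewrite subnn.
  case: k => [|k].
    by rewrite (_ : [set _ | _] = setT) ?probability_setT//; apply/seteqP;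
      split.
  by rewrite (_ : [set _ | _] = set0) ?measure0//; apply/seteqP; split.
by rewrite (pp_law poisson_N)// poisson_pmfE// mulr_gt0// subr_gt0.
Qed.

Lemma pp_measurable_increment u v : (0 <= u)%R -> (u <= v)%R ->
  measurable_fun setT (fun w => (N v w - N u w)%N).
Proof.
move=> u0 uv; have mNu := pp_measurable poisson_N u0.
have mNv := pp_measurable poisson_N (le_trans u0 uv).
apply: (measurable_fun_nat_comp (g := fun a w => (a - N u w)%N)) mNv _ => a.
exact: (measurableT_comp (f := fun b => (a - b)%N)).
Qed.

Lemma pp_joint_law u v a b : (0 <= u)%R -> (u <= v)%R ->
  P [set w | N u w = a /\ (N v w - N u w)%N = b] =
  (pois (lam * u) a)%:E * (pois (lam * (v - u)) b)%:E.
Proof.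
move=> u0 uv.
(* With the times 0, [u], [v], [v], ... the increments of index 0 and 1 are [N u] and [N v - N u],
   because [N] starts at 0. *)
pose t i : R := if i == 0%N then 0%R else if i == 1%N then u else v.
pose B i : set nat := if i == 0%N then [set a] else [set b].
have nt : nondecreasing_seq t.
  apply/nondecreasing_seqP => -[|[|i]]; rewrite /t//=.
have := pp_independent_increments poisson_N (lexx 0%R : (0 <= t 0%N)%R) nt.
move=> /(_ [fset 0%N; 1%N]%fset B).
rewrite big_fsetU1 ?inE//= big_seq_fset1 /B/= /t/=.
have := pp_increment_law a (lexx 0%R) u0; rewrite subr0 => <-.
rewrite -(pp_increment_law b u0 uv).
move=> <-; last by move=> i; case: ifP.
congr (P _); apply/seteqP; split=> w /=.
  move=> [Nu Nv] i /=; rewrite !inE => /orP[] /eqP -> /=.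
    by rewrite (pp_start poisson_N) subn0.
  by rewrite /t /=.
move=> h; split.
  by have := h 0%N; rewrite /= !inE /= (pp_start poisson_N) subn0; exact.
by have := h 1%N; rewrite /= !inE /=; exact.
Qed.

Let measurable_eq (A : T -> nat) a : measurable_fun setT A ->
  measurable [set w | A w = a].
Proof. by move=> mA; have := mA measurableT [set a]; rewrite setTI; exact. Qed.

Lemma pp_expectation u v (f : nat -> nat -> \bar R) :
  (0 <= u)%R -> (u <= v)%R -> (forall a b, 0 <= f a b) ->
  \int[P]_w f (N u w) (N v w - N u w)%N =
  \sum_(a <oo) (pois (lam * u) a)%:E *
    \sum_(b <oo) (pois (lam * (v - u)) b)%:E * f a b.
Proof.
move=> u0 uv f0.
have mu := pp_measurable poisson_N u0.
have muv := pp_measurable_increment u0 uv.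
have p0 k x : (0 <= x)%R -> 0 <= (pois (lam * x) k)%:E.
  by move=> x0; rewrite lee_fin pois_ge0// mulr_ge0// ltW.
have uv0 : (0 <= v - u)%R by rewrite subr_ge0.
rewrite (@integral_nat_partition _ _ _ P setT (N u) (fun a w => f a (N v w - N
  u w)%N))//; last first.
  by move=> a; exact: (measurableT_comp (f := f a)).
apply: eq_eseriesr => a _; rewrite setTI.
have ma : measurable [set w | N u w = a] := measurable_eq a mu.
rewrite (@integral_nat_partition _ _ _ P _ (fun w => N v w - N u w)%N (fun b w
  => f a b))//.
rewrite -nneseriesZl; last by move=> b _; rewrite mule_ge0// p0.
apply: eq_eseriesr => b _.
have mab : measurable [set w | N u w = a /\ (N v w - N u w)%N = b].
  by apply: measurableI => //; exact: measurable_eq.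
rewrite integral_cst// muleC -[X in X * _ = _]/(P [set w | N u w = a /\ (N v w
  - N u w)%N = b]).
by rewrite pp_joint_law// muleA.
Qed.

Lemma pp_expectation1 u (f : nat -> R) : (0 <= u)%R -> (forall a, 0 <= f a)%R ->
  \int[P]_w (f (N u w))%:E = \sum_(a <oo) (pois (lam * u) a)%:E * (f a)%:E.
Proof.
move=> u0 f0; rewrite (pp_expectation (f := fun a _ => (f a)%:E) u0 (lexx u));
  last first.
  by move=> a b; rewrite lee_fin.
apply: eq_eseriesr => a _; congr (_ * _); rewrite subrr mulr0.
under eq_eseriesr do rewrite muleC.
by rewrite nneseriesZl ?pois_series1 ?mule1// => b _; rewrite lee_fin pois_ge0.
Qed.

Lemma pp_probability u k : (0 <= u)%R ->
  P [set w | N u w = k] = (pois (lam * u) k)%:E.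
Proof.
move=> u0; have := pp_increment_law k (lexx 0%R) u0; rewrite subr0 => <-.
by congr (P _); apply/seteqP; split=> w /=; rewrite (pp_start poisson_N) subn0.
Qed.

End poisson_process_theory.

(** * The compound Poisson process and its inverse *)

Section compound_poisson.
Context d (T : measurableType d) (R : realType) (P : probability T R).
Variables (lam beta : R) (N : R -> T -> nat) (xi : nat -> {RV P >-> R}).
Hypothesis lam_gt0 : 0 < lam.
Hypothesis beta_gt0 : 0 < beta.
Hypothesis poisson_N : poisson_process P lam N.
Hypothesis independent_xi : mutually_independent P (fun j => xi j : T -> R).
Hypothesis exponential_xi : forall (j : nat) (A : set R), measurable A ->
  distribution P (xi j) A = exponential_prob beta A.
Hypothesis independent_N_xi : independent_systems P
  (process_sigma [set u : R | 0 <= u] N)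
  (process_sigma [set: nat] (fun j => xi j : T -> R)).
Notation mu := (@lebesgue_measure R).
Notation bsum := (bsum xi).
Local Open Scope ereal_scope.

Let E := compound_process N (fun j => xi j : T -> R).

Lemma compoundE u w : E u w = bsum 0 (N u w) w.
Proof. by []. Qed.

Lemma measurable_compound u : (0 <= u)%R -> measurable_fun setT (E u).
Proof.
move=> u0; apply: (measurable_fun_nat_comp (g := fun a w => bsum 0 a w)).
  exact: pp_measurable poisson_N _ u0.
by move=> a; exact: measurable_bsum.
Qed.

Lemma measurable_compound_le u t : (0 <= u)%R -> measurable [set w | (E u w <=
  t)%R].
Proof.
move=> u0; rewrite (_ : [set w | _] = E u @^-1` `]-oo, t]).
  by rewrite -[X in measurable X]setTI; exact: measurable_compound.
by apply/seteqP; split=> w /=; rewrite in_itv.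
Qed.

Let mNeq u a : (0 <= u)%R -> measurable [set w | N u w = a].
Proof.
move=> u0; rewrite -[X in measurable X]setTI.
exact: (pp_measurable poisson_N u0 measurableT (Y := [set a])).
Qed.

Let setI_process_sigma d' (U : measurableType d') (I : Type) (D : set I)
    (X : I -> T -> U) A B :
  process_sigma D X A -> process_sigma D X B -> process_sigma D X (A `&` B).
Proof.
exact: (@measurableI _ (g_sigma_algebraType (\bigcup_(i in D)
  preimage_set_system setT (X i) measurable))).
Qed.

Let sigma_bsum a t : process_sigma [set: nat] (fun j => xi j : T -> R)
  [set w | (bsum 0 a w <= t)%R].
Proof.
rewrite (_ : [set w | _] = bsum 0 a @^-1` `]-oo, t]).
  exact: bsum_process_sigma.
by apply/seteqP; split=> w /=; rewrite in_itv.
Qed.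

Lemma compound_law u t : (0 <= u)%R ->
  P [set w | (E u w <= t)%R] =
  \sum_(a <oo) (pois (lam * u) a)%:E * P [set w | (bsum 0 a w <= t)%R].
Proof.
move=> u0.
rewrite (measure_nat_partition P (measurable_compound_le t u0) (pp_measurable
  poisson_N u0)).
apply: eq_eseriesr => a _.
rewrite -(pp_probability lam_gt0 poisson_N a u0) -independent_N_xi.
- by congr (P _); apply/seteqP; split=> w /= [] => [+ <-|<-].
- exact: (process_sigma_preimage (B := [set a])).
- exact: sigma_bsum.
Qed.

Lemma compound_pair_law u v s t : (0 <= u)%R -> (u <= v)%R ->
  P [set w | ((E u w <= s) && (E v w <= t))%R] =
  \sum_(a <oo) (pois (lam * u) a)%:E * \sum_(b <oo) (pois (lam * (v - u)) b)%:E
    *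
    P [set w | ((bsum 0 a w <= s) && (bsum 0 (a + b) w <= t))%R].
Proof.
move=> u0 uv; have v0 := le_trans u0 uv.
have mI : measurable [set w | ((E u w <= s) && (E v w <= t))%R].
  by rewrite set_andb; apply: measurableI; exact: measurable_compound_le.
have mNu := pp_measurable poisson_N u0.
have mNv := pp_measurable_increment poisson_N u0 uv.
rewrite (measure_nat_partition P mI mNu); apply: eq_eseriesr => a _.
rewrite -nneseriesZl; last first.
  by move=> b _; rewrite mule_ge0// lee_fin pois_ge0// mulr_ge0 ?subr_ge0// ltW.
rewrite (measure_nat_partition P _ mNv); last first.
  by apply: measurableI => //; exact: mNeq.
apply: eq_eseriesr => b _.
rewrite muleA -(pp_joint_law lam_gt0 poisson_N a b u0 uv).
(* In terms of values instead of increments, the event visibly belongs to the sigma-algebra of [N];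
   monotone paths make the truncated subtraction reversible. *)
have -> : [set w | N u w = a /\ (N v w - N u w)%N = b] =
    N u @^-1` [set a] `&` N v @^-1` [set (a + b)%N].
  apply/seteqP; split=> w /= [Nu]; have := pp_nondecreasing poisson_N w u0 uv.
    by move=> le_uv <-; rewrite -Nu subnKC.
  by move=> _ ->; rewrite Nu addKn.
rewrite -independent_N_xi.
- congr (P _); apply/seteqP; split=> w /=.
    move=> [[/andP[]]]; rewrite !compoundE => Eu Ev Nu Nb.
    have Nv : N v w = (a + b)%N.
      by have := pp_nondecreasing poisson_N w u0 uv; rewrite -Nb -Nu => /subnKC.
    by split => //; rewrite -Nv -Nu Eu Ev.
  move=> [[Nu Nv]] /andP[Ea Eb]; rewrite !compoundE Nu Nv Ea Eb; split => //.
  by rewrite addKn.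
- by apply: setI_process_sigma; exact: process_sigma_preimage.
- by rewrite set_andb; apply: setI_process_sigma; exact: sigma_bsum.
Qed.

Let mpois a : measurable_fun [set: R] (fun u => (pois (lam * u) a)%:E).
Proof.
by apply/measurable_EFinP; apply: continuous_measurable_fun; exact:
  continuous_pois_scale.
Qed.

Let pois_lam_ge0 u a : (0 <= u)%R -> 0 <= (pois (lam * u) a)%:E.
Proof. by move=> u0; rewrite lee_fin pois_ge0// mulr_ge0// ltW. Qed.

Let mpois_mix (c : nat -> \bar R) : (forall a, 0 <= c a) ->
  measurable_fun (`[0%R, +oo[%classic : set R)
    (fun u => \sum_(a <oo) (pois (lam * u) a)%:E * c a).
Proof.
move=> c0; apply: ge0_emeasurable_sum.
  by move=> a u /=; rewrite in_itv/= andbT => u0 _; rewrite mule_ge0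
    ?pois_lam_ge0.
move=> a _; apply: measurable_funTS.
by apply: emeasurable_funM; [exact: mpois|exact: measurable_cst].
Qed.

Lemma integral_pois_mix (c : nat -> \bar R) : (forall a, 0 <= c a) ->
  \int[mu]_(u in `[0%R, +oo[) (\sum_(a <oo) (pois (lam * u) a)%:E * c a) =
  lam^-1%:E * \sum_(a <oo) c a.
Proof.
move=> c0; rewrite integral_nneseries//; last 2 first.
- move=> a; apply: measurable_funTS.
  by apply: emeasurable_funM; [exact: mpois|exact: measurable_cst].
- by move=> a u /=; rewrite in_itv/= andbT => u0; rewrite mule_ge0
    ?pois_lam_ge0.
rewrite -nneseriesZl//; apply: eq_eseriesr => a _.
rewrite ge0_integralZr//; last 2 first.
- by apply: measurable_funTS; exact: mpois.
- by move=> u /=; rewrite in_itv/= andbT; exact: pois_lam_ge0.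
by rewrite integral_pois_scaley.
Qed.

Lemma measurable_compound_law t :
  measurable_fun (`[0%R, +oo[%classic : set R) (fun u => P [set w | (E u w <=
    t)%R]).
Proof.
apply: eq_measurable_fun (mpois_mix (c := fun a => P [set w | (bsum 0 a w <=
  t)%R]) _) => //.
by move=> u; rewrite inE/= in_itv/= andbT => u0; rewrite compound_law.
Qed.

Lemma integral_compound_law t : (0 <= t)%R ->
  \int[mu]_(u in `[0%R, +oo[) P [set w | (E u w <= t)%R] =
  (lam^-1 * (1 + beta * t))%:E.
Proof.
move=> t0.
under eq_integral.
  move=> u; rewrite inE/= in_itv/= andbT => u0; rewrite compound_law//; over.
by rewrite integral_pois_mix// (sum_bsum_cdf beta_gt0 independent_xi).
Qed.

(** Writing the later time as [u + v] makes the weight of the increment depend on [v] alone, so each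
    of the two integrations yields a factor [1 / lam] and leaves the sum of [renewal_pair]. *)
Lemma integral_compound_pair_law s t : (0 <= s)%R -> (s <= t)%R ->
  \int[mu]_(u in `[0%R, +oo[) \int[mu]_(v in `[0%R, +oo[)
    P [set w | ((E u w <= s) && (E (u + v)%R w <= t))%R] =
  (lam ^- 2 * ((1 + beta * s) * (1 + beta * (t - s)) + beta * s
               + (beta * s) ^+ 2 / 2))%:E.
Proof.
move=> s0 st.
transitivity (\int[mu]_(u in `[0%R, +oo[) \sum_(a <oo) (pois (lam * u) a)%:E *
  (lam^-1%:E * \sum_(b <oo)
    P [set w | ((bsum 0 a w <= s) && (bsum 0 (a + b) w <= t))%R])).
  apply: eq_integral => u; rewrite inE/= in_itv/= andbT => u0.
  under eq_integral.
    move=> v; rewrite inE/= in_itv/= andbT => v0; rewrite compound_pair_law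
      ?lerDl// addrAC subrr add0r; over.
  rewrite integral_nneseries//; last 2 first.
  - by move=> a; apply: emeasurable_funM => //; exact: mpois_mix.
  - move=> a v /=; rewrite in_itv/= andbT => v0; rewrite mule_ge0
      ?pois_lam_ge0//.
    by apply: nneseries_ge0 => b _ _; rewrite mule_ge0 ?pois_lam_ge0.
  apply: eq_eseriesr => a _; rewrite ge0_integralZl ?pois_lam_ge0//.
  - by rewrite integral_pois_mix.
  - exact: mpois_mix.
  - move=> v /=; rewrite in_itv/= andbT => v0.
    by apply: nneseries_ge0 => b _ _; rewrite mule_ge0 ?pois_lam_ge0.
rewrite integral_pois_mix//; last first.
  by move=> a; rewrite mule_ge0 ?lee_fin ?invr_ge0 ?(ltW lam_gt0)//; exact:
    nneseries_ge0.
rewrite nneseriesZl; last by move=> a _; exact: nneseries_ge0.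
rewrite (renewal_pair beta_gt0 independent_xi)// -!EFinM mulrA.
by congr (_ * _)%:E; rewrite expr2 invfM.
Qed.

Let Y := inverse_process E.

Let compound_locally_constant w u : (0 <= u)%R ->
  exists2 e : R, (0 < e)%R & forall x, (u <= x)%R -> (x < u + e)%R -> E x w = E
    u w.
Proof.
move=> u0; have [e e0 he] := pp_locally_constant poisson_N w u0.
by exists e => // x ux xe; rewrite !compoundE he.
Qed.

(** Paths are constant just after every time, so the value at [u] is taken again at a rational time
    before [a]. This reduces events about all times to countably many. *)
Let compound_rat w u a : (0 <= u)%R -> (u < a)%R ->
  exists q : rat, [/\ (0 <= ratr q :> R)%R, (ratr q < a)%R & E (ratr q) w = E u
    w].
Proof.
move=> u0 ua; have [e e0 he] := compound_locally_constant w u0.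
have : (u < Num.min a (u + e))%R by rewrite lt_min ua ltrDl.
move=> /rat_in_itvoo[q]; rewrite in_itv/= lt_min => /and3P[uq qa qe].
exists q; split => //; first exact: le_trans (ltW uq).
by apply: he => //; exact: ltW.
Qed.

Let compound_le w u v : (forall j, 0 <= xi j w)%R -> (0 <= u)%R -> (u <= v)%R ->
  (E u w <= E v w)%R.
Proof.
move=> xi0 u0 uv; rewrite !compoundE.
rewrite -(subnKC (pp_nondecreasing poisson_N w u0 uv)) bsumD lerDl.
by apply: sumr_ge0 => j _; exact: xi0.
Qed.

Let hitting_lbound t w : has_lbound [set u | (0 <= u /\ t < E u w)%R].
Proof. by exists 0%R => u []. Qed.

Lemma inverse_ge0 t w : (0 <= Y t w)%R.
Proof.
rewrite /Y /inverse_process.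
have [->|/set0P ne] := eqVneq [set u | (0 <= u /\ t < E u w)%R] set0.
  by rewrite inf0.
by apply: lb_le_inf => // u [].
Qed.

Let compound_le_of_lt_inverse t u w : (0 <= u)%R -> (u < Y t w)%R -> (E u w <=
  t)%R.
Proof.
move=> u0 uY; rewrite leNgt; apply/negP => tE.
by move: uY; rewrite ltNge => /negP; apply; apply: ge_inf.
Qed.

(** The path keeps its value on some [[u, u + e)] and is nondecreasing, so [t] can be exceeded only
    from [u + e] on: right-continuity makes the inequality strict. That [t] is exceeded somewhere
    rules out the empty set, whose infimum counts as 0. *)
Let lt_inverse_of_compound_le t u w : (forall j, 0 <= xi j w)%R ->
  (exists n : nat, (t < E n%:R w)%R) -> (0 <= u)%R -> (E u w <= t)%R ->
  (u < Y t w)%R.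
Proof.
move=> xi0 [n tn] u0 Eu; have [e e0 he] := compound_locally_constant w u0.
apply: (@lt_le_trans _ _ (u + e)%R); first by rewrite ltrDl.
apply: lb_le_inf; first by exists n%:R; split.
move=> x [x0 tEx]; rewrite leNgt; apply/negP => xe.
move: tEx; rewrite ltNge => /negP; apply.
have [ux|xu] := leP u x; first by rewrite he.
by apply: le_trans Eu; apply: compound_le => //; exact: ltW.
Qed.

(* Were [E] bounded by [t] with positive probability, the finite integral of
   [P (E u <= t)] over [u >= 0] would diverge. *)
Let compound_unbounded_ae t : (0 <= t)%R ->
  {ae P, forall w, exists n : nat, (t < E n%:R w)%R}.
Proof.
move=> t0.
pose G := \bigcap_j [set w | (0 <= xi j w)%R].
pose B := \bigcap_n [set w | (E n%:R w <= t)%R].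
have mG : measurable G.
  apply: bigcapT_measurable => j.
  rewrite (_ : [set w | _] = xi j @^-1` `[0%R, +oo[); first exact:
    measurable_funPTI.
  by apply/seteqP; split=> w /=; rewrite in_itv/= andbT.
have mB : measurable B.
  by apply: bigcapT_measurable => n; exact: measurable_compound_le.
have mBG := measurableI _ _ mB mG.
have PBG u : (0 <= u)%R -> P (B `&` G) <= P [set w | (E u w <= t)%R].
  move=> u0; apply: le_measure; rewrite ?inE//; first exact:
    measurable_compound_le.
  move=> w [wB wG] /=.
  apply: le_trans (wB (Num.truncn u).+1 I).
  by apply: compound_le => //; [move=> j; exact: wG|exact/ltW/truncnS_gt].
have muy : mu `[0%R, +oo[ = +oo by rewrite lebesgue_measure_itv/= ltry.
have PBGle : P (B `&` G) * +oo <= (lam^-1 * (1 + beta * t))%:E.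
  rewrite -[X in _ * X]muy -(integral_cst mu (measurable_itv `[0%R, +oo[)).
  rewrite -(integral_compound_law t0).
  apply: ge0_le_integral => //.
  - exact: measurable_compound_law.
  - by move=> u /=; rewrite in_itv/= andbT; exact: PBG.
have PBG0 : P (B `&` G) = 0.
  apply/eqP; rewrite eq_le measure_ge0 andbT leNgt; apply/negP => PBG_gt0.
  by move: PBGle; rewrite gt0_muley.
have : {ae P, forall w, ~ (B `&` G) w}.
  by exists (B `&` G); split => // w /=; exact: contrapT.
apply: filterS2 (xi_ge0_ae exponential_xi) => w xi0 nBG.
apply: contrapT => h; apply: nBG; split => [n _ /=|j _]; last exact: xi0.
by rewrite leNgt; apply/negP => tn; apply: h; exists n.
Qed.

(** One null event serves for all [u]; [inverse_le_ae] relies on this, taking for [u] the random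
    time [Y t w]. *)
Lemma lt_inverse_ae t : (0 <= t)%R ->
  {ae P, forall w, forall u, (0 <= u)%R -> (u < Y t w)%R = (E u w <= t)%R}.
Proof.
move=> t0; apply: filterS2 (xi_ge0_ae exponential_xi) (compound_unbounded_ae
  t0).
move=> w xi0 En u u0; apply/idP/idP; first exact: compound_le_of_lt_inverse.
exact: lt_inverse_of_compound_le.
Qed.

(** If [Y t < Y s], then [E (Y t) <= s <= t], hence [Y t < Y t]. An exceptional event is
    unavoidable: where the path never exceeds [t], [Y t] is 0 while [Y s] may be positive. *)
Lemma inverse_le_ae s t : (0 <= s)%R -> (s <= t)%R ->
  {ae P, forall w, (Y s w <= Y t w)%R}.
Proof.
move=> s0 st; have t0 := le_trans s0 st.
apply: filterS2 (lt_inverse_ae s0) (lt_inverse_ae t0) => w hs ht.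
rewrite leNgt; apply/negP => ts; have Yt0 := inverse_ge0 t w.
by move: (ts); rewrite hs// => /le_trans/(_ st); rewrite -ht// ltxx.
Qed.

Lemma measurable_inverse t : measurable_fun setT (Y t).
Proof.
move=> mT; apply: (measurability _ (RGenInftyO.measurableE R)) => //.
move=> _ [_ [a ->] <-]; rewrite setTI.
have mE q : measurable [set w | (E (Num.max 0 (ratr q)) w <= t)%R].
  by apply: measurable_compound_le; rewrite le_max lexx.
have [a0|a0] := leP a 0%R.
  rewrite (_ : _ @^-1` _ = set0)//; apply/seteqP; split=> w //=; rewrite
    in_itv/=.
  by rewrite ltNge (le_trans a0)// inverse_ge0.
(* For [a > 0], [Y t w < a] holds either because [t] is exceeded at a rational time before [a], or
   because it is never exceeded, the infimum then being 0. Negative rationals are sent to 0. *)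
rewrite (_ : _ @^-1` _ =
  (\bigcup_(q in [set q : rat | (ratr q < a)%R]) ~` [set w | (E (Num.max 0
    (ratr q)) w <= t)%R])
  `|` \bigcap_(q in [set: rat]) [set w | (E (Num.max 0 (ratr q)) w <= t)%R]).
  apply: measurableU.
    rewrite bigcup_mkcond; apply: bigcupT_measurable_rat => q.
    by case: ifP => // _; exact: measurableC.
  rewrite -[X in measurable X]setCK setC_bigcap; apply: measurableC.
  by apply: bigcupT_measurable_rat => q; exact: measurableC.
have hit w u : (0 <= u)%R -> (t < E u w)%R -> forall b, (u < b)%R ->
    exists2 q : rat, (ratr q < b)%R & (t < E (Num.max 0 (ratr q)) w)%R.
  move=> u0 tE b ub; have [q [q0 qb Eq]] := compound_rat w u0 ub.
  by exists q => //; rewrite max_r// Eq.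
apply/seteqP; split=> w /=; rewrite in_itv/=.
- move=> Ya; have [allq|] := pselect (forall q : rat, (E (Num.max 0 (ratr q)) w
    <= t)%R).
    by right => q _; exact: allq.
  move=> /existsNP[q0 /negP]; rewrite -ltNge => tq0.
  have [] := @inf_lt R [set u | (0 <= u /\ t < E u w)%R] a _ Ya.
    by exists (Num.max 0 (ratr q0))%R; split; rewrite ?le_max ?lexx.
  move=> u [u0 tu] ua; left.
  have [q qa tq] := hit w u u0 tu a ua; exists q => //=.
  by apply/negP; rewrite -ltNge.
- case=> [[q /= qa /negP]|allq].
    rewrite -ltNge => tq; apply: (@le_lt_trans _ _ (Num.max 0 (ratr q))%R).
      by apply: ge_inf => //; split; rewrite ?le_max ?lexx.
    by rewrite gt_max a0.
  rewrite /Y /inverse_process (_ : [set u | _] = set0) ?inf0//.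
  apply/seteqP; split=> u //= [u0 tu].
  have [|q _ tq] := hit w u u0 tu (u + 1)%R; first by rewrite ltrDl.
  by move: (allq q I); rewrite /= leNgt tq.
Qed.

Let Y_ge0 := inverse_ge0.
Let mY := measurable_inverse.

Let mltY t : measurable [set z : T * R | (z.2 < Y t z.1)%R].
Proof.
have : measurable_fun setT (fun z : T * R => (z.2 < Y t z.1)%R).
  by apply: measurable_fun_ltr => //; exact: (measurableT_comp (mY t)).
by move=> /(_ measurableT [set true]); rewrite setTI; exact.
Qed.

Let mltY1 u t : measurable [set w | (u < Y t w)%R].
Proof.
rewrite (_ : [set w | _] = Y t @^-1` `]u, +oo[).
  by rewrite -[X in measurable X]setTI; exact: mY.
by apply/seteqP; split=> w /=; rewrite in_itv/= andbT.
Qed.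

Let mbool (p : T -> bool) : measurable [set w | p w] ->
  measurable_fun setT (fun w => ((p w)%:R)%:E : \bar R).
Proof.
move=> mp; apply/measurable_EFinP; rewrite (_ : (fun w => _) = \1_[set w | p
  w]).
  exact: measurable_indic.
by apply/funext => w; rewrite indicE mem_setE.
Qed.

Let eq_prob_ae (p q : T -> bool) : measurable [set w | p w] ->
  measurable [set w | q w] -> {ae P, forall w, p w = q w} ->
  P [set w | p w] = P [set w | q w].
Proof.
move=> mp mq pq; rewrite -!integral_bool//; apply: ae_eq_integral => //.
- exact: mbool.
- exact: mbool.
- by apply: filterS pq => w -> _.
Qed.

Lemma prob_lt_inverse u t : (0 <= u)%R -> (0 <= t)%R ->
  P [set w | (u < Y t w)%R] = P [set w | (E u w <= t)%R].
Proof.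
move=> u0 t0; apply: eq_prob_ae; [exact: mltY1|exact: measurable_compound_le|].
by apply: filterS (lt_inverse_ae t0) => w ->.
Qed.

Lemma prob_lt_inverse2 u v s t : (0 <= u)%R -> (0 <= v)%R -> (0 <= s)%R -> (0
  <= t)%R ->
  P [set w | ((u < Y s w) && (v < Y t w))%R] =
  P [set w | ((E u w <= s) && (E v w <= t))%R].
Proof.
move=> u0 v0 s0 t0; apply: eq_prob_ae.
- by rewrite set_andb; apply: measurableI; exact: mltY1.
- by rewrite set_andb; apply: measurableI; exact: measurable_compound_le.
- by apply: filterS2 (lt_inverse_ae s0) (lt_inverse_ae t0) => w -> // -> .
Qed.

(** Layer formula for [Y t]. It asks for [F] nondecreasing on the half-line, so it is applied to the
    identity and to Poisson tails, not to Poisson weights. *)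
Lemma expectation_inverse t (F f : R -> R) : (0 <= t)%R ->
  (forall x, (0 <= x)%R -> 0 <= f x)%R ->
  (forall x : R, is_derive x 1%R F (f x)) -> continuous f ->
  \int[P]_w (F (Y t w) - F 0)%:E =
  \int[mu]_(u in `[0%R, +oo[) ((f u)%:E * P [set w | (E u w <= t)%R]).
Proof.
move=> t0 f0 dF cf.
have mf : measurable_fun [set: R] (EFin \o f).
  by apply/measurable_EFinP; exact: continuous_measurable_fun.
have f0' x : `[0%R, +oo[%classic x -> 0 <= (EFin \o f) x.
  by rewrite /= in_itv/= andbT => x0; rewrite lee_fin f0.
transitivity (\int[P]_w \int[mu]_(u in `[0%R, +oo[)
    ((EFin \o f) u * (\1_[set z : T * R | (z.2 < Y t z.1)%R] (w, u))%:E)).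
  apply: eq_integral => w _; rewrite -(integral_itvy_below (Y_ge0 t w) dF cf).
  by apply: eq_integral => x _; rewrite /= indicE mem_setE.
rewrite (expectation_layer P (measurable_itv `[0%R, +oo[) mf f0' (mltY t)).
apply: eq_integral => u; rewrite inE/= in_itv/= andbT => u0.
by congr (_ * _); exact: prob_lt_inverse.
Qed.

Lemma inverse_mean t : (0 <= t)%R ->
  \int[P]_w (Y t w)%:E = (lam^-1 * (1 + beta * t))%:E.
Proof.
move=> t0.
rewrite -(integral_compound_law t0).
have := @expectation_inverse t id (cst 1%R) t0.
under eq_integral do rewrite subr0.
move=> ->//; last by move=> x; exact: cvg_cst.
by apply: eq_integral => u _; rewrite mul1e.
Qed.

(** The probability of at least [k] failures; [nbin_tail] at [k'] means strictly more than [k'],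
    hence the shift. In this form the recurrence is that of [ptail], uniformly in [k]. *)
Let tl c m k : R := if k is k'.+1 then nbin_tail c lam m k' else 1%R.

Let tl_rec c m k : (0 <= c)%R -> (nbin c lam m k + tl c m k.+1 = tl c m k)%R.
Proof.
move=> c0; have cl : (c + lam != 0)%R by rewrite gt_eqF// ltr_wpDl.
by case: k => [|k] /=; [exact: nbin_tail0|exact: nbin_tailS].
Qed.

Let nneseries_trunc (r : nat -> R) m : (forall a, (0 <= r a)%R) ->
  \sum_(a <oo) ((a <= m)%N%:R * r a)%:E = (\sum_(a < m.+1) r a)%:E.
Proof.
move=> r0; rewrite (@nneseries_split _ _ 0%N m.+1); last first.
  by move=> k _; rewrite lee_fin mulr_ge0.
rewrite add0n big_mkord -sumEFin [X in _ + X]eseries0 ?adde0; last first.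
  by move=> i mi _; rewrite leqNgt mi mul0r.
by apply: eq_bigr => i _; rewrite -ltnS ltn_ord mul1r.
Qed.

(** The derivative [c pois (c u) k] times the weight [pois (lam u) a] merges into one weight of rate
    [c + lam] by [pois_mul], which integrates to [1 / (c + lam)]. The remaining factor
    [ptail (beta t) a] is expanded over the values [m >= a] of a Poisson variable of mean
    [beta t]. *)
Lemma expectation_ptail_inverse t c k : (0 <= t)%R -> (0 <= c)%R ->
  \int[P]_w (ptail (c * Y t w) k)%:E =
  \sum_(m <oo) (pois (beta * t) m)%:E * (tl c m k)%:E.
Proof.
move=> t0 c0; have bt0 : (0 <= beta * t)%R by rewrite mulr_ge0 ?(ltW beta_gt0).
case: k => [|k] /=.
  under eq_integral do rewrite ptail0.
  rewrite integral_cst// mul1e [LHS]probability_setT.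
  by under eq_eseriesr do rewrite mule1; rewrite pois_series1.
have cl : (0 < c + lam)%R by rewrite ltr_wpDl.
transitivity (\int[P]_w ((ptail (c * Y t w) k.+1) - ptail (c * 0) k.+1)%:E).
  by apply: eq_integral => w _; rewrite mulr0 ptail0l subr0.
rewrite (expectation_inverse (F := fun y => ptail (c * y) k.+1) t0 _ (fun u =>
  is_derive_ptail_scale c u k)); last 2 first.
- by move=> x x0; rewrite mulr_ge0 ?pois_ge0 ?mulr_ge0.
- by move=> u; apply: cvgMr; exact: continuous_pois_scale.
(* The coefficient of [ptail (beta t) a] once [u] is integrated out. It is the summand of
   [nbin_tail c lam m k], which for fixed [m] collects the [a <= m]. *)
pose r a : R := ('C(a + k, k)%:R * c ^+ k.+1 * lam ^+ a / (c + lam) ^+ (a +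
  k).+1)%R.
have r0 a : (0 <= r a)%R by rewrite /r !mulr_ge0 ?invr_ge0 ?exprn_ge0 ?(ltW
  lam_gt0) ?(ltW cl).
transitivity (\sum_(a <oo) (r a)%:E * (ptail (beta * t) a)%:E).
  transitivity (\int[mu]_(u in `[0%R, +oo[) \sum_(a <oo)
     ((r a * (c + lam) * ptail (beta * t) a)%:E * (pois ((c + lam) * u) (a +
       k))%:E)).
    apply: eq_integral => u; rewrite inE/= in_itv/= andbT => u0.
    rewrite compound_law//.
    rewrite -nneseriesZl; last first.
      by move=> a _; rewrite mule_ge0 ?lee_fin ?pois_ge0 ?mulr_ge0 ?(ltW
        lam_gt0).
    apply: eq_eseriesr => a _.
    rewrite (bsum_cdf beta_gt0 independent_xi exponential_xi)// -!EFinM; congr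
      EFin.
    transitivity (c * (pois (c * u) k * pois (lam * u) a) * ptail (beta * t)
      a)%R.
      by ring.
    rewrite pois_mul ?lt0r_neq0//.
    rewrite /r exprS exprSr; field.
    by rewrite lt0r_neq0// expf_neq0// lt0r_neq0.
  have mp a : measurable_fun (`[0%R, +oo[%classic : set R) (fun u => (pois ((c
    + lam) * u) a)%:E).
    apply: measurable_funTS; apply/measurable_EFinP; apply:
      continuous_measurable_fun.
    exact: continuous_pois_scale.
  have p0 a u : `[0%R, +oo[%classic u -> 0 <= (pois ((c + lam) * u) a)%:E.
    by rewrite /= in_itv/= andbT => u0; rewrite lee_fin pois_ge0 ?mulr_ge0
      ?(ltW cl).
  have k0 a : (0 <= r a * (c + lam) * ptail (beta * t) a)%R.
    by rewrite mulr_ge0 ?ptail_ge0// mulr_ge0 ?r0 ?(ltW cl).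
  rewrite integral_nneseries//; last 2 first.
  - by move=> a; apply: emeasurable_funM; [exact: measurable_cst|exact: mp].
  - by move=> a u Du; rewrite mule_ge0 ?p0// lee_fin.
  apply: eq_eseriesr => a _.
  rewrite ge0_integralZl; [|by []|exact: mp|exact: p0|by rewrite lee_fin].
  rewrite integral_pois_scaley// -!EFinM; congr EFin.
  by field; rewrite lt0r_neq0.
transitivity (\sum_(a <oo) \sum_(m <oo) ((pois (beta * t) m)%:E * ((a <=
  m)%N%:R * r a)%:E)).
  apply: eq_eseriesr => a _; rewrite ptailE// -nneseriesZl; last first.
    by move=> m _; rewrite lee_fin mulr_ge0 ?pois_ge0.
  by apply: eq_eseriesr => m _; rewrite -!EFinM; congr EFin; ring.
rewrite nneseries_interchange; last first.
  by move=> a m; rewrite -EFinM lee_fin mulr_ge0 ?pois_ge0// mulr_ge0.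
apply: eq_eseriesr => m _; rewrite nneseriesZl; last first.
  by move=> a _; rewrite lee_fin mulr_ge0.
by rewrite nneseries_trunc.
Qed.

(* Conditionally on the number [m] of partial sums below [t], [Y t] is a sum of
   [m.+1] independent exponentials, whence a negative binomial mixture. *)
Lemma expectation_pois_inverse t c k : (0 <= t)%R -> (0 <= c)%R ->
  \int[P]_w (pois (c * Y t w) k)%:E =
  \sum_(m <oo) (pois (beta * t) m)%:E * (nbin c lam m k)%:E.
Proof.
move=> t0 c0; have bt0 : (0 <= beta * t)%R by rewrite mulr_ge0 ?(ltW beta_gt0).
have cl : (0 < c + lam)%R by rewrite ltr_wpDl.
have cY0 w : (0 <= c * Y t w)%R by rewrite mulr_ge0.
have mcY : measurable_fun setT (fun w => c * Y t w)%R by exact: measurable_funM.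
have nbin0 m : (0 <= nbin c lam m k)%R.
  by rewrite /nbin !mulr_ge0 ?invr_ge0 ?exprn_ge0 ?(ltW lam_gt0) ?(ltW cl).
have tl0 m : (0 <= tl c m k.+1)%R.
  rewrite /= /nbin_tail sumr_ge0// => i _.
  by rewrite !mulr_ge0 ?invr_ge0 ?exprn_ge0 ?(ltW lam_gt0) ?(ltW cl).
have mpt j : measurable_fun setT (fun w => (ptail (c * Y t w) j)%:E).
  by apply/measurable_EFinP; exact: (measurableT_comp (measurable_ptail j)).
have mpo : measurable_fun setT (fun w => (pois (c * Y t w) k)%:E).
  by apply/measurable_EFinP; exact: (measurableT_comp (measurable_pois k)).
have fin : \int[P]_w (ptail (c * Y t w) k.+1)%:E \is a fin_num.
  rewrite ge0_fin_numE; last by apply: integral_ge0 => w _; rewrite lee_fin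
    ptail_ge0.
  apply: (@le_lt_trans _ _ (\int[P]_w (cst 1) w)); last first.
    by rewrite integral_cst// mul1e [ltLHS]probability_setT ltry.
  apply: ge0_le_integral => //.
  - by move=> w _; rewrite lee_fin ptail_ge0.
  - by move=> w _; rewrite lee_fin ptail_le1.
(* [pois k] is [ptail k - ptail k.+1]; adding the finite mean of the second tail to both sides keeps
   integrands and summands nonnegative. *)
rewrite -[LHS](addeK _ fin) -[RHS](addeK _ fin); congr (_ - _).
rewrite -ge0_integralD//; last 2 first.
- by move=> w _; rewrite lee_fin pois_ge0.
- by move=> w _; rewrite lee_fin ptail_ge0.
under eq_integral do rewrite -EFinD -ptailS.
rewrite !expectation_ptail_inverse//.
rewrite -nneseriesD; last 2 first.
- by move=> m _ _; rewrite -EFinM lee_fin mulr_ge0 ?pois_ge0.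
- by move=> m _ _; rewrite -EFinM lee_fin mulr_ge0 ?pois_ge0.
apply: eq_eseriesr => m _; rewrite -muleDr// -EFinD.
by rewrite tl_rec.
Qed.

Let above s t (z : T * R) : \bar R :=
  ((z.2 < Y s z.1)%R%:R)%:E * (Num.max 0 (Y t z.1 - z.2)%R)%:E.

Let measurable_above s t : measurable_fun setT (above s t).
Proof.
apply: emeasurable_funM; apply/measurable_EFinP.
  apply: measurableT_comp => //; apply: measurable_fun_ltr => //.
  exact: (measurableT_comp (mY s)).
apply: measurable_maxr => //; apply: measurable_funB => //.
exact: (measurableT_comp (mY t)).
Qed.

Let above_ge0 s t z : 0 <= above s t z.
Proof. by rewrite mule_ge0// lee_fin le_max lexx. Qed.

(** The factor [(Y t - u)^+] is the length of the set of [v >= 0] with [u + v < Y t], so the left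
    side is the double integral of the probability that [u < Y s] and [u + v < Y t]. *)
Let expectation_above s t : (0 <= s)%R -> (s <= t)%R ->
  \int[P]_w \int[mu]_(u in `[0%R, +oo[) above s t (w, u) =
  (lam ^- 2 * ((1 + beta * s) * (1 + beta * (t - s)) + beta * s
               + (beta * s) ^+ 2 / 2))%:E.
Proof.
move=> s0 st; have t0 := le_trans s0 st.
rewrite -(integral_compound_pair_law s0 st).
rewrite expectation_integral_swap//.
apply: eq_integral => u; rewrite inE/= in_itv/= andbT => u0.
pose C := [set z : T * R | ((u < Y s z.1) && (u + z.2 < Y t z.1))%R].
have mC : measurable C.
  have : measurable_fun setT (fun z : T * R => (u < Y s z.1) && (u + z.2 < Y t
    z.1))%R.
    apply: measurable_and; apply: measurable_fun_ltr => //.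
    - exact: (measurableT_comp (mY s)).
    - exact: measurable_funD.
    - exact: (measurableT_comp (mY t)).
  by move=> /(_ measurableT [set true]); rewrite setTI; exact.
transitivity (\int[P]_w \int[mu]_(v in `[0%R, +oo[) (cst 1 v * (\1_C (w,
  v))%:E)).
  apply: eq_integral => w _; rewrite /above/=.
  have max0 : (0 <= Num.max 0 (Y t w - u))%R by rewrite le_max lexx.
  have did (x : R) : is_derive x 1%R (id : R -> R) (cst 1%R x) by exact:
    is_derive_id.
  have := integral_itvy_below max0 did (fun x => cvg_cst _).
  rewrite subr0 => <-.
  rewrite -ge0_integralZl; [|by []| | |by rewrite lee_fin]; last 2 first.
  - apply: measurable_funTS; apply: emeasurable_funM; apply/measurable_EFinP =>
      //.
    by apply: measurableT_comp => //; exact: measurable_fun_ltr.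
  - by move=> v _; rewrite mule_ge0// lee_fin.
  apply: eq_integral => v; rewrite inE/= in_itv/= andbT => v0.
  rewrite !mul1e indicE mem_setE lt_max ltNge v0/= ltrBrDl -EFinM.
  by rewrite -natrM mulnb.
rewrite expectation_layer//.
apply: eq_integral => v; rewrite inE/= in_itv/= andbT => v0.
by rewrite mul1e; exact: (prob_lt_inverse2 u0 (addr_ge0 u0 v0) s0 t0).
Qed.

(* If [Y s <= Y t], then [Y s * Y t] is the sum of the integrals over
   [0 <= u < Y s] of [Y t - u] and of [Y s - u]. *)
Lemma inverse_product_moment s t : (0 <= s)%R -> (s <= t)%R ->
  \int[P]_w (Y s w * Y t w)%:E =
  (lam ^- 2 * (2 + beta * t + 3 * (beta * s) + beta ^+ 2 * s * t))%:E.
Proof.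
move=> s0 st; have t0 := le_trans s0 st.
transitivity (\int[P]_w (\int[mu]_(u in `[0%R, +oo[) above s t (w, u) +
   \int[mu]_(u in `[0%R, +oo[) above s s (w, u))).
  (* Only almost everywhere, because [Y s <= Y t] may fail on a null event. *)
  apply: ae_eq_integral => //.
  - by apply/measurable_EFinP; exact: measurable_funM.
  - by apply: emeasurable_funD; exact: measurable_fun_inner_integral.
  apply: filterS (inverse_le_ae s0 st) => w Yst _.
  (* For [y = Y t] and [y = Y s] the two values add up to [Y s * Y t], the squares cancelling. *)
  have aboveE (y : R) : (Y s w <= y)%R ->
      \int[mu]_(u in `[0%R, +oo[) (((u < Y s w)%R%:R)%:E * (Num.max 0 (y -
        u)%R)%:E)
      = (y * Y s w - Y s w ^+ 2 / 2)%:E.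
    move=> Yy.
    have dF (x : R) : is_derive x 1%R (fun u : R => y * u - u ^+ 2 / 2 : R)%R
      (y - x)%R.
      by apply: is_derive_eq; rewrite /GRing.scale/=; field.
    have cf : continuous (fun x : R => y - x)%R.
      by move=> x; apply: cvgB; [exact: cvg_cst|exact: cvg_id].
    have := integral_itvy_below (Y_ge0 s w) dF cf.
    rewrite mulr0 expr0n/= mul0r subr0 subr0 => <-.
    apply: eq_integral => u _; rewrite muleC.
    case: (ltP u (Y s w)) => [uY|_]; last by rewrite !mule0.
    by rewrite max_r// subr_ge0 (le_trans (ltW uY)).
  rewrite /above/= !aboveE// -EFinD; congr EFin.
  by field.
rewrite ge0_integralD//; last 4 first.
- by move=> w _; exact: integral_ge0.
- exact: measurable_fun_inner_integral.
- by move=> w _; exact: integral_ge0.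
- exact: measurable_fun_inner_integral.
rewrite !expectation_above// -EFinD; congr EFin.
by rewrite subrr; field; rewrite lt0r_neq0.
Qed.

End compound_poisson.

(** * Time change *)

Section measurable_time_change.
Context d (U : measurableType d) (R : realType).

Lemma measurable_fun_nat_le (g : U -> nat) :
  (forall k, measurable [set z | (g z <= k)%N]) -> measurable_fun setT g.
Proof.
move=> mg _ B _; rewrite setTI.
have mk k : measurable [set z | g z = k].
  case: k => [|k].
    by rewrite (_ : [set z | _] = [set z | (g z <= 0)%N])//; apply/seteqP;
      split=> z /=; rewrite leqn0 => /eqP.
  rewrite (_ : [set z | _] = [set z | (g z <= k.+1)%N] `\` [set z | (g z <=
    k)%N]).
    exact: measurableD.
  apply/seteqP; split=> z /=; first by move=> ->; rewrite leqnn ltnn.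
  by move=> [gk /negP]; rewrite -ltnNge => kg; apply/eqP; rewrite eqn_leq gk.
rewrite (_ : g @^-1` B = \bigcup_(k in B) [set z | g z = k]).
  exact: bigcup_measurable.
by apply/seteqP; split=> [z Bz|z [k Bk /= gk]]; [exists (g z)|rewrite gk].
Qed.

(* Right-continuity of a counting process makes evaluation at a random time
   measurable: [A (B z) z <= k] iff [A q z <= k] for some rational [q > B z]. *)
Lemma measurable_random_time (A : R -> U -> nat) (B : U -> R) :
  (forall q, 0 <= q -> measurable_fun setT (A q)) ->
  (forall z u v, 0 <= u -> u <= v -> (A u z <= A v z)%N) ->
  (forall z u, 0 <= u -> exists2 e, 0 < e & forall x, u <= x -> x < u + e -> A
    x z = A u z) ->
  measurable_fun setT B -> (forall z, 0 <= B z) ->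
  measurable_fun setT (fun z => A (B z) z).
Proof.
move=> mA ndA rcA mB B0; apply: measurable_fun_nat_le => k.
pose r (q : rat) : R := Num.max 0 (ratr q).
have r0 q : 0 <= r q by rewrite le_max lexx.
rewrite (_ : [set z | _] = \bigcup_(q in [set: rat])
    (B @^-1` `]-oo, r q[ `&` A (r q) @^-1` [set j | (j <= k)%N])).
  apply: bigcupT_measurable_rat => q; apply: measurableI.
    by rewrite -[X in measurable X]setTI; exact: mB.
  by rewrite -[X in measurable X]setTI; exact: mA.
apply/seteqP; split=> z /=.
  move=> Ak; have [e e0 he] := rcA z _ (B0 z).
  have [q] : exists q, ratr q \in `](B z), (B z + e)[ by apply: rat_in_itvoo;
    rewrite ltrDl.
  rewrite in_itv/= => /andP[Bq qe]; exists q => //=.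
  have q0 : 0 <= ratr q :> R by rewrite (le_trans (B0 z))// ltW.
  by rewrite /r max_r// in_itv/= Bq he// ltW.
move=> [q _ /= []]; rewrite in_itv/= => Bq; apply: leq_trans.
by apply: ndA => //; exact: ltW.
Qed.

End measurable_time_change.

Section time_change.
Context d (T : measurableType d) (R : realType) (P : probability T R).
Variables (lam1 : R) (N1 : R -> T -> nat) (Y : R -> T -> R).
Hypothesis lam1_gt0 : 0 < lam1.
Hypothesis poisson_N1 : poisson_process P lam1 N1.
Hypothesis mY : forall t, measurable_fun setT (Y t).
Hypothesis Y_ge0 : forall t w, 0 <= Y t w.
Hypothesis independent_N1_Y :
  independent_systems P (process_sigma [set u : R | 0 <= u] N1)
    (process_sigma [set t : R | 0 <= t] Y).
Local Open Scope ereal_scope.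

Lemma measurable_time_changed t : measurable_fun setT (time_changed N1 Y t).
Proof.
apply: (measurable_random_time (A := N1) (B := Y t)) => //.
- by move=> q q0; exact: (pp_measurable poisson_N1 q0).
- by move=> z u v u0 uv; exact: (pp_nondecreasing poisson_N1 z u0 uv).
- by move=> z u u0; exact: (pp_locally_constant poisson_N1 z u0).
Qed.

(** The two arguments of [N1 (Y t w') w] carry different sigma-algebras, generated by [N1] and by
    [Y]. Joint measurability is proved for their product, since independence is given for these
    two. *)
Lemma time_changed_expectation s t (f : nat -> nat -> \bar R) :
  (0 <= s)%R -> (0 <= t)%R -> (forall a b, 0 <= f a b) ->
  \int[P]_w f (time_changed N1 Y s w) (time_changed N1 Y t w) =
  \int[P]_w' \int[P]_w f (N1 (Y s w') w) (N1 (Y t w') w).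
Proof.
move=> s0 t0 f0.
pose G1 := \bigcup_(u in [set u : R | (0 <= u)%R]) preimage_set_system setT (N1
  u) measurable.
pose G2 := \bigcup_(u in [set u : R | (0 <= u)%R]) preimage_set_system setT (Y
  u) measurable.
have mZ r : (0 <= r)%R -> measurable_fun setT
    (fun z : g_sigma_algebraType G1 * g_sigma_algebraType G2 => N1 (Y r z.2)
      z.1).
  move=> r0; apply: (measurable_random_time (A := fun u (z :
    g_sigma_algebraType G1 * g_sigma_algebraType G2) => N1 u z.1)
    (B := fun z : g_sigma_algebraType G1 * g_sigma_algebraType G2 => Y r z.2))
      => //.
  - move=> q q0; apply: (measurableT_comp (f := N1 q : g_sigma_algebraType G1
      -> nat)) => //.
    by move=> _ B mB; rewrite setTI; exact: process_sigma_preimage.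
  - by move=> z u v u0 uv; exact: (pp_nondecreasing poisson_N1 z.1 u0 uv).
  - by move=> z u u0; exact: (pp_locally_constant poisson_N1 z.1 u0).
  - apply: (measurableT_comp (f := Y r : g_sigma_algebraType G2 -> R)) => //.
    by move=> _ B mB; rewrite setTI; exact: process_sigma_preimage.
pose phi (z : g_sigma_algebraType G1 * g_sigma_algebraType G2) :=
  f (N1 (Y s z.2) z.1) (N1 (Y t z.2) z.1).
have mphi : measurable_fun setT phi.
  apply: (measurable_fun_nat_comp (A := fun z : g_sigma_algebraType G1 *
    g_sigma_algebraType G2 => N1 (Y s z.2) z.1)
    (g := fun a (z : g_sigma_algebraType G1 * g_sigma_algebraType G2) => f a
      (N1 (Y t z.2) z.1))).
    exact: mZ.
  by move=> a; apply: (measurableT_comp (f := f a)) => //; exact: mZ.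
apply: (independent_systems_integral (phi := phi)) => //.
- apply: process_sigma_measurable => u u0; exact: (pp_measurable poisson_N1 u0).
- exact: process_sigma_measurable.
- by move=> z; exact: f0.
Qed.

Lemma time_changed_expectation1 t (f : nat -> R) :
  (0 <= t)%R -> (forall a, 0 <= f a)%R ->
  \int[P]_w (f (time_changed N1 Y t w))%:E =
  \int[P]_w \sum_(a <oo) (pois (lam1 * Y t w) a)%:E * (f a)%:E.
Proof.
move=> t0 f0; rewrite (time_changed_expectation (f := fun a _ => (f a)%:E) t0
  t0).
  by apply: eq_integral => w' _; rewrite (pp_expectation1 lam1_gt0 poisson_N1).
by move=> a b; rewrite lee_fin.
Qed.

Lemma time_changed_probability t k : (0 <= t)%R ->
  P [set w | time_changed N1 Y t w = k] = \int[P]_w (pois (lam1 * Y t w) k)%:E.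
Proof.
move=> t0; have mk : measurable [set w | time_changed N1 Y t w == k].
  rewrite (_ : [set w | _] = time_changed N1 Y t @^-1` [set k]).
    by rewrite -[X in measurable X]setTI; exact: measurable_time_changed.
  by apply/seteqP; split=> w /= /eqP.
rewrite (_ : [set w | _] = [set w | time_changed N1 Y t w == k]); last first.
  by apply/seteqP; split=> w /= /eqP.
rewrite -integral_bool// (time_changed_expectation1 (f := fun a => (a ==
  k)%:R))//.
apply: eq_integral => w _; have p0 a : 0 <= (pois (lam1 * Y t w) a)%:E.
  by rewrite lee_fin pois_ge0// mulr_ge0// ltW.
rewrite (@nneseriesD1 _ _ k)//; last by move=> a _; rewrite mule_ge0// lee_fin.
rewrite eqxx mule1 eseries0 ?adde0// => a _ /= ak.
by rewrite (negbTE ak) mule0.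
Qed.

Lemma time_changed_mean t : (0 <= t)%R ->
  \int[P]_w (time_changed N1 Y t w)%:R%:E = lam1%:E * \int[P]_w (Y t w)%:E.
Proof.
move=> t0; rewrite (time_changed_expectation1 (f := fun a => a%:R))//.
rewrite -ge0_integralZl//; [|exact/measurable_EFinP|by move=> w _; rewrite
  lee_fin|by rewrite lee_fin ltW].
by apply: eq_integral => w _; rewrite pois_mean ?mulr_ge0 ?(ltW lam1_gt0).
Qed.

(** Serves [time_changed_product], which compares two integrands that agree only almost everywhere
    and therefore needs both to be measurable. *)
Let measurable_inner s t (f : nat -> nat -> \bar R) : (forall a b, 0 <= f a b)
  ->
  measurable_fun setT (fun w' => \int[P]_w f (N1 (Y s w') w) (N1 (Y t w') w)).
Proof.
move=> f0.
have mZ r : measurable_fun setT (fun z : T * T => N1 (Y r z.2) z.1).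
  apply: (measurable_random_time (A := fun u (z : T * T) => N1 u z.1)
    (B := fun z : T * T => Y r z.2)) => //.
  - move=> q q0; apply: (measurableT_comp (f := N1 q)) => //.
    exact: (pp_measurable poisson_N1 q0).
  - by move=> z u v u0 uv; exact: (pp_nondecreasing poisson_N1 z.1 u0 uv).
  - by move=> z u u0; exact: (pp_locally_constant poisson_N1 z.1 u0).
  - exact: (measurableT_comp (mY r)).
pose phi (z : T * T) := f (N1 (Y s z.2) z.1) (N1 (Y t z.2) z.1).
have mphi : measurable_fun setT phi.
  apply: (measurable_fun_nat_comp (A := fun z : T * T => N1 (Y s z.2) z.1)
    (g := fun a (z : T * T) => f a (N1 (Y t z.2) z.1))).
    exact: mZ.
  by move=> a; apply: (measurableT_comp (f := f a)) => //; exact: mZ.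
apply: eq_measurable_fun (measurable_fun_fubini_tonelli_G (m1 := P) phi mphi _)
  => //.
by move=> z; exact: f0.
Qed.

Lemma time_changed_product s t : (0 <= s)%R -> (0 <= t)%R ->
  {ae P, forall w, (Y s w <= Y t w)%R} ->
  \int[P]_w ((time_changed N1 Y s w)%:R * (time_changed N1 Y t w)%:R)%:E =
  (lam1 ^+ 2)%:E * \int[P]_w (Y s w * Y t w)%:E + lam1%:E * \int[P]_w (Y s
    w)%:E.
Proof.
move=> s0 t0 Yst; have lam1_ge0 := ltW lam1_gt0.
have f0 a b : 0 <= ((a%:R * b%:R)%:E : \bar R) by rewrite lee_fin mulr_ge0.
rewrite (time_changed_expectation (f := fun a b => (a%:R * b%:R)%:E))//.
have mYY : measurable_fun setT (fun w => (Y s w * Y t w)%:E).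
  by apply/measurable_EFinP; exact: measurable_funM.
have mYs : measurable_fun setT (fun w => (Y s w)%:E) by exact/measurable_EFinP.
transitivity (\int[P]_w ((lam1 ^+ 2)%:E * (Y s w * Y t w)%:E + lam1%:E * (Y s
  w)%:E)).
  apply: ae_eq_integral => //.
  - exact: (@measurable_inner s t (fun a b => (a%:R * b%:R)%:E) f0).
  - by apply: emeasurable_funD; apply: emeasurable_funM.
  apply: filterS Yst => w Yst _.
  transitivity (\int[P]_w' ((N1 (Y s w) w')%:R *
      ((N1 (Y s w) w')%:R + (N1 (Y t w) w' - N1 (Y s w) w')%N%:R))%:E).
    apply: eq_integral => w' _; rewrite -natrD subnKC//.
    exact: (pp_nondecreasing poisson_N1 w' (Y_ge0 s w) Yst).
  rewrite (pp_expectation lam1_gt0 poisson_N1 (f := fun a b => (a%:R * (a%:R +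
    b%:R))%:E) (Y_ge0 s w) Yst); last first.
    by move=> a b; rewrite lee_fin mulr_ge0// addr_ge0.
  rewrite pois_pair_moment ?mulr_ge0 ?subr_ge0// -!EFinM -EFinD.
  by congr EFin; ring.
rewrite ge0_integralD//; last 4 first.
- by move=> w _; rewrite -EFinM lee_fin !mulr_ge0 ?exprn_ge0.
- exact: emeasurable_funM.
- by move=> w _; rewrite -EFinM lee_fin mulr_ge0.
- exact: emeasurable_funM.
congr (_ + _).
  rewrite ge0_integralZl//; first by move=> w _; rewrite lee_fin mulr_ge0.
  by rewrite lee_fin exprn_ge0.
by rewrite ge0_integralZl// => w _; rewrite lee_fin.
Qed.

End time_change.

(** * The Mittag-Leffler function at integer parameters *)

Section mittag_leffler_series.
Context {R : realType}.

(** All Gamma values are factorials, and [(j + k)! / (k! j!)] is the binomial coefficient; one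
    [1 / j!] remains. *)
Lemma mittag_leffler_natE (k : nat) (z : R) :
  mittag_leffler 1 1 k.+1%:R z =
  limn (series (fun j => 'C(j + k, k)%:R * (z ^+ j / j`!%:R))).
Proof.
rewrite /mittag_leffler; congr (limn (series _)); apply/funext => j.
have -> : k.+1%:R + j%:R = (j + k).+1%:R :> R by rewrite -natrD addSn addnC.
have -> : 1 * j%:R + 1 = j.+1%:R :> R by rewrite mul1r natr1.
rewrite !Gamma_natS.
have := bin_fact (leq_addl j k); rewrite addnK => /(congr1 (fun m => m%:R : R)).
rewrite !natrM => <-; field.
by rewrite !pnatr_eq0 -!lt0n !fact_gt0.
Qed.

(** [mittag_leffler] is a real limit, to be matched with the extended sum once the series is known
    to converge. Finiteness of the sum supplies this, so that no growth estimate of the coefficients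
    enters. *)
Lemma mittag_leffler_nneseries (c : R) (k : nat) (z : R) : 0 < c -> 0 <= z ->
  (\sum_(j <oo) (c * ('C(j + k, k)%:R * (z ^+ j / j`!%:R)))%:E < +oo)%E ->
  (\sum_(j <oo) (c * ('C(j + k, k)%:R * (z ^+ j / j`!%:R)))%:E =
   (c * mittag_leffler 1 1 k.+1%:R z)%:E)%E.
Proof.
move=> c0 z0; rewrite mittag_leffler_natE; set u := fun j => 'C(j + k, k)%:R *
  _.
have u0 j : 0 <= u j by rewrite /u !mulr_ge0 ?exprn_ge0.
have -> : (\sum_(j <oo) (c * u j)%:E = c%:E * \sum_(j <oo) (u j)%:E)%E.
  rewrite -nneseriesZl; last by move=> j _; rewrite lee_fin.
  by apply: eq_eseriesr => j _; rewrite EFinM.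
move=> fin; rewrite EFinM; congr (_ * _)%E.
have cu : cvgn (series u).
  apply: nnseries_is_cvg => //; move: fin.
  have : (0 <= \sum_(j <oo) (u j)%:E)%E by apply: nneseries_ge0 => j _ _;
    rewrite lee_fin.
  case: (\sum_(j <oo) _)%E => [r _ _||//]; first exact: ltry.
  by move=> _; rewrite gt0_muley ?lte_fin.
rewrite -EFin_lim//; congr (limn _); apply/funext => n /=.
by rewrite /series/= sumEFin.
Qed.

End mittag_leffler_series.

Theorem theorem5 (d : measure_display) (T : measurableType d) (R : realType)
    (P : probability T R) (lam lam1 beta : R)
    (lam_gt0 : 0 < lam) (lam1_gt0 : 0 < lam1) (beta_gt0 : 0 < beta)
    (N N1 : R -> T -> nat) (xi : nat -> {RV P >-> R})
    (poisson_N : poisson_process P lam N)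
    (independent_xi : mutually_independent P (fun j => xi j : T -> R))
    (exponential_xi : forall (j : nat) (A : set R), measurable A ->
      distribution P (xi j) A = exponential_prob beta A)
    (independent_N_xi : independent_systems P
      (process_sigma [set u : R | 0 <= u] N)
      (process_sigma [set: nat] (fun j => xi j : T -> R)))
    (poisson_N1 : poisson_process P lam1 N1) :
  let E := compound_process N (fun j => xi j : T -> R) in
  let Y := inverse_process E in
  let Z := time_changed N1 Y in
  let ZR := fun t w => (Z t w)%:R : R in
  independent_systems P (process_sigma [set u : R | 0 <= u] N1)
    (process_sigma [set t : R | 0 <= t] Y) ->
  [/\ forall (t : R) (k : nat), 0 <= t ->
        P [set w | Z t w = k] =
        (expR (- beta * t) *
         (lam * lam1 ^+ k / (lam1 + lam) ^+ k.+1) *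
         mittag_leffler 1 1 k.+1%:R (lam * t * beta / (lam1 + lam)))%:E,
      forall t : R, 0 <= t ->
        expectation P (ZR t) = (lam1 / lam * (beta * t + 1))%:E,
      forall t : R, 0 <= t ->
        variance P (ZR t) =
        (lam1 ^+ 2 / lam ^+ 2 * (2 * beta * t + 1) +
         lam1 / lam * (beta * t + 1))%:E,
      forall t s : R, 0 <= t -> 0 <= s ->
        covariance P (ZR t) (ZR s) =
        (lam1 ^+ 2 / lam ^+ 2 * (2 * beta * Num.min t s + 1) +
         lam1 / lam * (beta * Num.min t s + 1))%:E
    & forall t theta : R, 0 <= t -> 0 <= theta ->
        expectation P (fun w => expR (- theta * ZR t w)) =
        (lam / (lam + lam1 * (1 - expR (- theta))) *
         expR (- beta * t * (lam1 * (1 - expR (- theta)) /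
                             (lam + lam1 * (1 - expR (- theta))))))%:E ].
Proof.
move=> E Y Z ZR indep_N1_Y.
have mY t : measurable_fun setT (Y t) := @measurable_inverse _ _ _ _ _ _ xi
  poisson_N t.
have Y_ge0 t w : 0 <= Y t w := inverse_ge0 N xi t w.
have mZ t : measurable_fun setT (ZR t).
  apply: (measurableT_comp (f := fun n : nat => n%:R : R)) => //.
  exact: (measurable_time_changed poisson_N1 mY Y_ge0).
have bt0 t : 0 <= t -> 0 <= beta * t by move=> t0; rewrite mulr_ge0 ?(ltW
  beta_gt0).
have meanY t : 0 <= t -> (\int[P]_w (Y t w)%:E = (lam^-1 * (1 + beta *
  t))%:E)%E.
  exact: (inverse_mean lam_gt0 beta_gt0 poisson_N independent_xi exponential_xi
    independent_N_xi).
have meanZ t : 0 <= t -> (\int[P]_w (ZR t w)%:E = (lam1 / lam * (beta * t +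
  1))%:E)%E.
  move=> t0; rewrite (time_changed_mean lam1_gt0 poisson_N1 mY Y_ge0
    indep_N1_Y)//.
  by rewrite meanY// -EFinM; congr EFin; ring.
have poisY t c k : 0 <= t -> 0 <= c ->
    (\int[P]_w (pois (c * Y t w) k)%:E =
     \sum_(m <oo) (pois (beta * t) m)%:E * (nbin c lam m k)%:E)%E.
  by move=> t0 c0; exact: (expectation_pois_inverse lam_gt0 beta_gt0 poisson_N
    independent_xi exponential_xi independent_N_xi).
have meanZZ s t : 0 <= s -> s <= t -> (\int[P]_w (ZR s w * ZR t w)%:E =
    (lam1 ^+ 2 / lam ^+ 2 * (2 + beta * t + 3 * (beta * s) + beta ^+ 2 * s * t)
     + lam1 / lam * (1 + beta * s))%:E)%E.
  move=> s0 st; have t0 := le_trans s0 st.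
  rewrite (time_changed_product lam1_gt0 poisson_N1 mY Y_ge0 indep_N1_Y s0 t0);
    last first.
    exact: (inverse_le_ae lam_gt0 beta_gt0 poisson_N independent_xi
      exponential_xi independent_N_xi).
  rewrite (inverse_product_moment lam_gt0 beta_gt0 poisson_N independent_xi
    exponential_xi independent_N_xi)//.
  by rewrite meanY// -!EFinM -EFinD; congr EFin; rewrite !mulrA.
have LZ t : 0 <= t -> ZR t \in Lfun P 1.
  move=> t0; apply/Lfun1_integrable/integrableP; split; first
    exact/measurable_EFinP.
  under eq_integral do rewrite gee0_abs ?lee_fin//.
  by rewrite meanZ// ltry.
have LZZ s t : 0 <= s -> s <= t -> (ZR s * ZR t)%R \in Lfun P 1.
  move=> s0 st; apply/Lfun1_integrable/integrableP; split.
    by apply/measurable_EFinP; exact: measurable_funM.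
  under eq_integral do rewrite gee0_abs ?lee_fin ?mulr_ge0//.
  by rewrite meanZZ// ltry.
have covZ s t : 0 <= s -> s <= t -> covariance P (ZR s) (ZR t) =
    (lam1 ^+ 2 / lam ^+ 2 * (2 * beta * s + 1) + lam1 / lam * (beta * s +
      1))%:E.
  move=> s0 st; have t0 := le_trans s0 st.
  rewrite covarianceE ?LZ ?LZZ//.
  (* All terms in [t] cancel: [2 + beta t + 3 beta s + beta^2 s t - (1 + beta s) (1 + beta t) = 1 +
     2 beta s]. *)
  rewrite unlock meanZZ// !meanZ// -EFinM -EFinB; congr EFin.
  by field; rewrite gt_eqF.
split.
- move=> t k t0.
  rewrite (time_changed_probability lam1_gt0 poisson_N1 mY Y_ge0 indep_N1_Y)//.
  rewrite poisY ?(ltW lam1_gt0)//.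
  set c := expR (- beta * t) * (lam * lam1 ^+ k / (lam1 + lam) ^+ k.+1).
  set z := lam * t * beta / (lam1 + lam).
  have l0 : 0 < lam1 + lam by rewrite addr_gt0.
  have c0 : 0 < c by rewrite /c !mulr_gt0 ?expR_gt0 ?exprn_gt0 ?invr_gt0
    ?exprn_gt0.
  have z0 : 0 <= z by rewrite /z !mulr_ge0 ?invr_ge0 ?(ltW l0) ?(ltW lam_gt0)
    ?(ltW beta_gt0).
  (* The factors free of [m], among them one spare [lam], go into [c]; the [m]-th powers assemble to
     [z ^ m]. *)
  have termE m : ((pois (beta * t) m)%:E * (nbin lam1 lam m k)%:E =
      (c * ('C(m + k, k)%:R * (z ^+ m / m`!%:R)))%:E)%E.
    rewrite -EFinM /pois /nbin /c /z mulNr; congr EFin.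
    rewrite !exprMn exprVn !exprS exprD.
    by field; rewrite !expf_neq0 ?gt_eqF//= ?ltr0n ?fact_gt0.
  under eq_eseriesr do rewrite termE.
  apply: mittag_leffler_nneseries => //.
  under eq_eseriesr do rewrite -termE.
  (* The sum is the probability that [Z t = k], hence at most 1: this is where convergence of the
     series comes from. *)
  rewrite -poisY ?(ltW lam1_gt0)//.
  rewrite -(time_changed_probability lam1_gt0 poisson_N1 mY Y_ge0 indep_N1_Y)//.
  rewrite (le_lt_trans (probability_le1 _ _)) ?ltry//.
  rewrite -[X in measurable X]/(Z t @^-1` [set k]) -[X in measurable X]setTI.
  by apply: (measurable_time_changed poisson_N1 mY Y_ge0).
- by move=> t t0; rewrite unlock meanZ.
- by move=> t t0; rewrite /variance covZ.
- move=> t s t0 s0; have [ts|st] := leP t s.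
    by rewrite covZ.
  by rewrite covarianceC covZ// ltW.
- move=> t theta t0 theta0.
  rewrite unlock.
  have e1 : expR (- theta) <= 1 by rewrite -expR0 ler_expR oppr_le0.
  set c := lam1 * (1 - expR (- theta)).
  have c0 : 0 <= c by rewrite mulr_ge0 ?subr_ge0 ?(ltW lam1_gt0).
  have cl : 0 < lam + c by rewrite ltr_wpDr.
  (* Averaging [N1] out leaves [exp(-c Y)], the Poisson weight at 0 of intensity [c Y], with
     [c >= 0] because [theta >= 0]. *)
  transitivity (\int[P]_w (pois (c * Y t w) 0)%:E)%E.
    rewrite (time_changed_expectation1 lam1_gt0 poisson_N1 mY Y_ge0 indep_N1_Y
      (f := fun a => expR (- theta * a%:R)))//.
    apply: eq_integral => w _; rewrite pois0r.
    under eq_eseriesr do rewrite expRM_natr.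
    rewrite pois_gen_fun ?expR_ge0 ?mulr_ge0 ?(ltW lam1_gt0)//.
    by congr (expR (- _))%:E; rewrite /c; ring.
  rewrite poisY//.
  (* With no failures the negative binomial weights are the powers [(lam / (lam + c)) ^ (m + 1)],
     and the sum is a Poisson generating function at [lam / (lam + c)]. *)
  transitivity (\sum_(m <oo) (lam / (lam + c))%:E * ((pois (beta * t) m)%:E *
    ((lam / (lam + c)) ^+ m)%:E))%E.
    apply: eq_eseriesr => m _; rewrite -!EFinM; congr EFin.
    rewrite /nbin bin0 addn0 expr0 (addrC c) !exprS expr_div_n.
    by field; rewrite expf_neq0 ?gt_eqF.
  rewrite nneseriesZl; last first.
    by move=> m _; rewrite -EFinM lee_fin mulr_ge0 ?pois_ge0 ?bt0 ?exprn_ge0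
      ?divr_ge0 ?(ltW cl) ?(ltW lam_gt0).
  rewrite pois_gen_fun ?bt0 ?divr_ge0 ?(ltW cl) ?(ltW lam_gt0)// -EFinM.
  congr (_ * expR _)%:E.
  by field; rewrite gt_eqF.
Qed.
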